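(* Let $\varphi$ be a positive measurable function on the irreducible symmetric cone $\Omega$. The following assertions are equivalent. (1) The measure $d\mu(x+iy)=\varphi(y)\,dx\,dy$ on $T_\Omega$ is a Carleson measure for the Hardy space $H^2(T_\Omega)$. (2) The function $\varphi$ is integrable on $\Omega$, i.e. $\int_\Omega \varphi(y)\,dy<\infty$. (3) For some (equivalently, for all) real $\alpha>\frac nr-\frac12$, there exists a positive constant $C_{\alpha,\varphi}$ such that $$\int_\Omega \Delta^{-2\alpha+\frac nr}(y+t)\,\varphi(y)\,dy\le C_{\alpha,\varphi}\,\Delta^{-2\alpha+\frac nr}(t)\quad\text{for every } t\in\Omega.$$
   Context: $V$ is a Euclidean (simple Jordan algebra) vector space of dimension $n$, $\Omega\subset V$ is an irreducible symmetric cone of rank $r$, self-dual with respect to the scalar product $\langle\cdot,\cdot\rangle$ of $V$, and $\Delta$ is the determinant function of $\Omega$ (the Jordan algebra determinant, positive on $\Omega$). $T_\Omega=V+i\Omega$ is the tube domain over $\Omega$. The Hardy space $H^2(T_\Omega)$ is the space of holomorphic functions $F$ on $T_\Omega$ with $$\|F\|_{H^2(T_\Omega)}:=\Big(\sup_{y\in\Omega}\int_V|F(x+iy)|^2dx\Big)^{1/2}<\infty.$$ A positive Borel measure $\mu$ on $T_\Omega$ is called a Carleson measure for $H^2(T_\Omega)$ if there is a constant $C>0$ such that $\int_{T_\Omega}|F(z)|^2d\mu(z)\le C\|F\|_{H^2(T_\Omega)}^2$ for every $F\in H^2(T_\Omega)$. *)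

(* Defs.v *)
From HB Require Import structures.
From mathcomp Require Import all_boot all_order all_algebra.
From mathcomp Require Import all_classical all_reals all_analysis.
From mathcomp Require Import measurable_realfun complex.
From mathcomp Require mpoly.

Set Implicit Arguments.
Unset Strict Implicit.
Unset Printing Implicit Defensive.

Import Order.TTheory GRing.Theory Num.Theory.
Import numFieldNormedType.Exports.

Local Open Scope classical_set_scope.
Local Open Scope ring_scope.

(* The vector space V of dimension n is 'rV[R]_n: a basis of V is fixed, which
   need not be orthonormal for the scalar product of V, so that dx is defined up
   to a positive constant factor. *)

(* The sigma-algebra of 'rV[T]_n is generated by the coordinates.  For T a
   realType it is the Borel one: coordinates are continuous, and open sets are
   measurable by [open_measurable_rV] below. *)
Section measurable_rV.
Context d (T : measurableType d) (n : nat).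

Definition rV_coord (i : 'I_n) (x : 'rV[T]_n) : T := x ord0 i.

Let rV_set0 : g_sigma_preimage rV_coord set0.
Proof. exact: sigma_algebra0. Qed.

Let rV_setC A : g_sigma_preimage rV_coord A -> g_sigma_preimage rV_coord (~` A).
Proof. exact: sigma_algebraC. Qed.

Let rV_bigcup (F : (set 'rV[T]_n)^nat) :
  (forall i, g_sigma_preimage rV_coord (F i)) ->
  g_sigma_preimage rV_coord (\bigcup_i (F i)).
Proof. exact: sigma_algebra_bigcup. Qed.

HB.instance Definition _ := @isMeasurable.Build (measure_tuple_display d)
  'rV[T]_n (g_sigma_preimage rV_coord) rV_set0 rV_setC rV_bigcup.

Lemma measurable_rV_coord (i : 'I_n) : measurable_fun [set: 'rV[T]_n] (rV_coord i).
Proof.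
move=> _ Y mY; rewrite setTI; apply: sub_sigma_algebra => /=.
rewrite -bigcup_seq/=; exists i => /=; first by rewrite mem_index_enum.
by exists Y => //; rewrite setTI.
Qed.

Lemma measurable_fun_rV d1 (T1 : measurableType d1) (f : T1 -> 'rV[T]_n) :
  (forall i, measurable_fun [set: T1] (rV_coord i \o f)) ->
  measurable_fun [set: T1] f.
Proof.
move=> mf _ A mA; rewrite setTI.
suff : g_sigma_preimage rV_coord `<=` [set B | measurable (f @^-1` B)] by apply.
apply: smallest_sub.
  split => [|B mB|F mF] /=.
  - by rewrite preimage_set0.
  - by rewrite setTD -preimage_setC; exact: measurableC.
  - by rewrite preimage_bigcup; exact: bigcupT_measurable.
rewrite -bigcup_seq/= => B [i _ [Y mY <-]] /=; rewrite setTI.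
by have := mf i measurableT _ mY; rewrite setTI.
Qed.

End measurable_rV.

Lemma open_measurable_rV (R : realType) (n : nat) (O : set 'rV[R]_n) :
  open O -> measurable O.
Proof.
move=> oO.
pose B (u : 'rV[rat]_n * nat) : set 'rV[R]_n :=
  \bigcap_(i in [set: 'I_n])
    (rV_coord i @^-1` ball (ratr (u.1 ord0 i) : R) (u.2.+1%:R^-1)).
have mB u : measurable (B u).
  apply: fin_bigcap_measurable => // i _.
  rewrite -[X in measurable X]setTI; apply: measurable_rV_coord => //.
  exact: measurable_ball.
have -> : O = \bigcup_u (if `[< B u `<=` O >] then B u else set0).
  apply/seteqP; split => [x Ox|x [u _]]; last by case: asboolP => // BO /BO.
  have /nbhs_ballP[e /= e0 eO] : nbhs x O by exact: open_nbhs_nbhs.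
  have [k ke] : exists k : nat, k.+1%:R^-1 < e / 2.
    exists (Num.truncn (e / 2)^-1).
    by rewrite invf_plt ?posrE ?divr_gt0// truncnS_gt.
  have k0 : (0 : R) < k.+1%:R^-1 by rewrite invr_gt0.
  have /all_sig[q qx] (i : 'I_n) :
      {q : rat | ball (ratr q : R) (k.+1%:R^-1) (x ord0 i)}.
    apply: cid.
    have [z [+ [q _ qz]]] := @dense_rat R (ball (x ord0 i) k.+1%:R^-1)
      (ex_intro _ (x ord0 i) (ballxx _ k0)) (ball_open _ _).
    by rewrite -qz => bq; exists q; exact: ball_sym.
  have Bx : B (\row_i q i, k) x by move=> i _; rewrite /= mxE; exact: qx.
  exists (\row_i q i, k) => //; case: asboolP => // -[] y By; apply: eO.
  split=> // i j; rewrite ord1.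
  have e2 : k.+1%:R^-1 + k.+1%:R^-1 <= e by rewrite [leRHS]splitr lerD// ltW.
  apply: (le_ball e2); apply: ball_triangle (By j Logic.I).
  by apply: ball_sym; exact: Bx j Logic.I.
apply: countable_bigcupT_measurable => [|u]; last by case: asboolP.
exact: countableP.
Qed.

(* The library has this only as an instance that does not get inferred. *)
Lemma product_sigma_finite d1 d2 (T1 : measurableType d1)
    (T2 : measurableType d2) (R : realType)
    (m1 : {sigma_finite_measure set T1 -> \bar R})
    (m2 : {sigma_finite_measure set T2 -> \bar R}) :
  sigma_finite setT (m1 \x m2)%E.
Proof.
have /sigma_finiteP[F [TF ndF Foo]] := sigma_finiteT m1.
have /sigma_finiteP[G [TG ndG Goo]] := sigma_finiteT m2.
exists (fun n => F n `*` G n).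
  rewrite -setXTT TF TG predeqE => -[x y]; split.
    move=> [/= [n _ Fnx] [k _ Gky]]; exists (maxn n k) => //; split.
    - by move: x Fnx; exact/subsetPset/ndF/leq_maxl.
    - by move: y Gky; exact/subsetPset/ndG/leq_maxr.
  by move=> [n _ []/= ? ?]; split; exists n.
move=> k; have [? ?] := Foo k; have [? ?] := Goo k.
split; first exact: measurableX.
by rewrite product_measure1E// lte_mul_pinfty// ge0_fin_numE.
Qed.

Section lebesgue_rV.
Variable R : realType.
Local Open Scope ereal_scope.

Definition rV_cons n (u : R * 'rV[R]_n) : 'rV[R]_n.+1 := row_mx u.1%:M u.2.

Lemma rV_cons0 n (u : R * 'rV[R]_n) : rV_cons u ord0 ord0 = u.1.
Proof.
transitivity ((u.1%:M : 'M[R]_1) ord0 ord0); last by rewrite mxE eqxx mulr1n.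
have -> : ord0 = lshift n (ord0 : 'I_1) :> 'I_n.+1 by exact/val_inj.
exact: (row_mxEl (u.1%:M : 'M[R]_1) u.2).
Qed.

Lemma rV_consS n (u : R * 'rV[R]_n) i :
  rV_cons u ord0 (lift ord0 i) = u.2 ord0 i.
Proof.
have -> : lift ord0 i = rshift 1 i :> 'I_n.+1 by exact/val_inj.
exact: (row_mxEr (u.1%:M : 'M[R]_1) u.2).
Qed.

Lemma measurable_rV_cons n : measurable_fun [set: R * 'rV[R]_n] (@rV_cons n).
Proof.
apply: measurable_fun_rV => i; have [j ->|->] := unliftP ord0 i.
  rewrite (_ : _ \o _ = rV_coord j \o snd).
    by apply: measurableT_comp => //; exact: measurable_rV_coord.
  by apply/funext => u; exact: rV_consS.
by rewrite (_ : _ \o _ = fst)//; apply/funext => u; exact: rV_cons0.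
Qed.

Definition rV_uncons n (x : 'rV[R]_n.+1) : R * 'rV[R]_n :=
  (x ord0 ord0, \row_i x ord0 (lift ord0 i)).

Lemma rV_consK n : cancel (@rV_cons n) (@rV_uncons n).
Proof.
move=> u; rewrite /rV_uncons rV_cons0 [RHS]surjective_pairing; congr pair.
by apply/rowP => i; rewrite mxE rV_consS.
Qed.

Lemma measurable_rV_uncons n : measurable_fun [set: 'rV[R]_n.+1] (@rV_uncons n).
Proof.
apply: measurable_fun_pair; first exact: measurable_rV_coord.
apply: measurable_fun_rV => i.
rewrite (_ : _ \o _ = rV_coord (lift ord0 i)).
  exact: measurable_rV_coord.
by apply/funext => x; rewrite /rV_coord/= mxE.
Qed.

Section succ.
Variables (n : nat) (mu : {sigma_finite_measure set 'rV[R]_n -> \bar R}).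

Let nu : {measure set (measurableTypeR R * 'rV[R]_n)%type -> \bar R} :=
  (@lebesgue_measure R \x mu).

Definition lebesgue_rV_cons : set 'rV[R]_n.+1 -> \bar R :=
  pushforward nu (@rV_cons n).

Let m0 : lebesgue_rV_cons set0 = 0.
Proof. by rewrite /lebesgue_rV_cons /pushforward preimage_set0 measure0. Qed.

Let m_ge0 A : 0 <= lebesgue_rV_cons A.
Proof. by rewrite /lebesgue_rV_cons /pushforward; exact: measure_ge0. Qed.

Let m_sigma_additive : semi_sigma_additive lebesgue_rV_cons.
Proof.
have mpre A : measurable A -> measurable (@rV_cons n @^-1` A).
  by move=> mA; rewrite -[X in measurable X]setTI; exact: measurable_rV_cons.
move=> F mF tF mUF; rewrite /lebesgue_rV_cons /pushforward preimage_bigcup.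
apply: measure_semi_sigma_additive => //.
- by move=> i; exact: mpre.
- apply/trivIsetP => /= i j _ _ ij; rewrite -preimage_setI.
  by move/trivIsetP : tF => /(_ _ _ _ _ ij) ->//; rewrite preimage_set0.
- by rewrite -preimage_bigcup; exact: mpre.
Qed.

Let m_sigma_finite : sigma_finite setT lebesgue_rV_cons.
Proof.
have [F TF mF] := product_sigma_finite (@lebesgue_measure R) mu.
exists (fun k => @rV_uncons n @^-1` F k).
  by rewrite -preimage_bigcup -TF preimage_setT.
move=> k; have [mFk Fk] := mF k; split.
  by rewrite -[X in measurable X]setTI; exact: measurable_rV_uncons.
rewrite /lebesgue_rV_cons /pushforward -comp_preimage (_ : _ \o _ = id)//.
by apply/funext => u; exact: rV_consK.
Qed.

HB.instance Definition _ := isMeasure.Build _ _ _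
  lebesgue_rV_cons m0 m_ge0 m_sigma_additive.
HB.instance Definition _ := Measure_isSigmaFinite.Build _ _ _
  lebesgue_rV_cons m_sigma_finite.

End succ.

(* Lebesgue measure of R^n: the n-fold product of the one of R. *)
Fixpoint lebesgue_rV n : {sigma_finite_measure set 'rV[R]_n -> \bar R} :=
  if n is k.+1 then lebesgue_rV_cons (lebesgue_rV k) else \d_(0%R : 'rV[R]_0).

End lebesgue_rV.
Arguments lebesgue_rV {R n}.

(* Jordan algebras, following Faraut and Koranyi, Analysis on Symmetric Cones. *)

Record euclidean_jordan_algebra (R : realType) (n : nat) :=
  EuclideanJordanAlgebra {
  jmul : 'rV[R]_n -> 'rV[R]_n -> 'rV[R]_n ;
  jone : 'rV[R]_n ;
  jdot : 'rV[R]_n -> 'rV[R]_n -> R ;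
  jmulC : commutative jmul ;
  jmul_linear : forall x, linear (jmul x) ;
  jmul1 : left_id jone jmul ;
  jordan_identity : forall x y,
    jmul x (jmul (jmul x x) y) = jmul (jmul x x) (jmul x y) ;
  jdotC : forall x y, jdot x y = jdot y x ;
  jdot_linear : forall x, scalar (jdot x) ;
  jdot_gt0 : forall x, x != 0 -> 0 < jdot x x ;
  jdot_associative : forall x y z, jdot (jmul x y) z = jdot y (jmul x z)
}.

Section jordan.
Variables (R : realType) (n : nat) (J : euclidean_jordan_algebra R n).
Local Notation V := 'rV[R]_n.

Definition simple_jordan_algebra :=
  (0 < n)%N /\
  forall I : {vspace V}, (forall x a, x \in I -> jmul J a x \in I) ->
    I = 0%VS \/ I = fullv.

Definition jpow (x : V) (k : nat) : V := iter k (jmul J x) (jone J).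

Definition jeval (p : {poly R}) (x : V) : V :=
  \sum_(i < size p) p`_i *: jpow x i.

Definition minimal_polynomial (x : V) (p : {poly R}) :=
  [/\ p \is monic, jeval p x = 0 &
      forall q, q != 0 -> jeval q x = 0 -> (size p <= size q)%N].

(* [size p] is one more than the degree of p. *)
Definition jordan_rank (r : nat) :=
  (exists x p, minimal_polynomial x p /\ size p = r.+1) /\
  (forall x p, minimal_polynomial x p -> (size p <= r.+1)%N).

(* The minimal polynomial of a regular x is
   'X^r - a_1(x) 'X^(r - 1) + ... + (-1)^r a_r(x) with a_1, ..., a_r polynomials
   on V, and the determinant is a_r.  Regular elements being dense, this
   characterizes it. *)
Definition jordan_determinant (r : nat) (Delta : V -> R) :=
  (exists P : mpoly.mpoly n R,
     forall x, Delta x = mpoly.meval (fun i => x ord0 i) P) /\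
  (forall x p, minimal_polynomial x p -> size p = r.+1 ->
     Delta x = (-1) ^+ r * p`_0).

Definition dual_cone (U : {vspace V}) (A : set V) : set V :=
  [set y | y \in U /\ forall x, closure A x -> x != 0 -> 0 < jdot J x y].

Record symmetric_cone (U : {vspace V}) (A : set V) : Prop := SymmetricCone {
  symmetric_cone_neq0 : A !=set0 ;
  symmetric_cone_open : exists2 O : set V, open O & A = O `&` [set` U] ;
  symmetric_cone_convex : forall x y (a b : R), A x -> A y -> 0 < a -> 0 < b ->
    A (a *: x + b *: y) ;
  symmetric_cone_self_dual : dual_cone U A = A ;
  symmetric_cone_homogeneous : forall x y, A x -> A y ->
    exists g : 'End(V), [/\ (g @: U)%VS = U, g @` A = A & g x = y]
}.

Definition irreducible_cone (A : set V) :=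
  ~ exists (U1 U2 : {vspace V}) (A1 A2 : set V),
    [/\ U1 != 0%VS, U2 != 0%VS, (U1 + U2)%VS = fullv & (U1 :&: U2)%VS = 0%VS] /\
    [/\ symmetric_cone U1 A1, symmetric_cone U2 A2 &
        A = [set x | exists x1 x2, [/\ A1 x1, A2 x2 & x = x1 + x2]]].

(* Besides being an irreducible symmetric cone, Omega is required to be the cone
   attached to the Jordan algebra J, that is the interior of the set of squares. *)
Record irreducible_symmetric_cone (Omega : set V) : Prop :=
  IrreducibleSymmetricCone {
  irreducible_symmetric_cone_symmetric : symmetric_cone fullv Omega ;
  irreducible_symmetric_cone_irreducible : irreducible_cone Omega ;
  irreducible_symmetric_cone_squares : Omega = (range (fun x => jmul J x x))°
}.

Lemma irreducible_symmetric_cone_open (Omega : set V) :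
  irreducible_symmetric_cone Omega -> open Omega.
Proof. by move=> [_ _ ->]; exact: open_interior. Qed.

End jordan.

Section tube.
Variables (R : realType) (n : nat).
Local Notation V := 'rV[R]_n.
(* Seen as a numFieldType, R[i] is a normed space over itself, so that
   [differentiable] below means that there is a C-linear differential. *)
Local Notation C := (R[i] : numFieldType).
Local Open Scope ereal_scope.

(* x + iy; the tube domain is parametrized by the pairs (x, y) with y in Omega. *)
Definition cplx (x y : V) : 'rV[C]_n := (\row_j (x ord0 j +i* y ord0 j)%C)%R.

Definition tube_domain (Omega : set V) : set 'rV[C]_n :=
  [set cplx z.1 z.2 | z in setT `*` Omega].

Definition holomorphic_on (D : set 'rV[C]_n) (F : 'rV[C]_n -> C) :=
  forall z, D z -> differentiable F z.

Definition sqr_abs (w : R[i]) : R := (Normc.normc w ^+ 2)%R.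

Definition hardy_norm (Omega : set V) (F : 'rV[C]_n -> C) : \bar R :=
  ereal_sup [set \int[lebesgue_rV]_x (sqr_abs (F (cplx x y)))%:E
            | y in Omega] `^ 2^-1.

Definition hardy_space (Omega : set V) (F : 'rV[C]_n -> C) :=
  holomorphic_on (tube_domain Omega) F /\ hardy_norm Omega F < +oo.

Definition carleson_measure (Omega : set V)
    (mu : {measure set (V * V)%type -> \bar R}) :=
  exists2 c : R, (0 < c)%R & forall F, hardy_space Omega F ->
    \int[mu]_(z in setT `*` Omega) (sqr_abs (F (cplx z.1 z.2)))%:E
      <= c%:E * hardy_norm Omega F ^+ 2.

Section tube_measure.
Variables (Omega : set V) (phi : V -> R).
Hypotheses (oOmega : open Omega) (phi_ge0 : forall y, Omega y -> (0 <= phi y)%R).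
Hypothesis mphi : measurable_fun Omega phi.

Definition tube_density (A : set (V * V)) : \bar R :=
  \int[lebesgue_rV \x lebesgue_rV]_(z in A `&` (setT `*` Omega)) (phi z.2)%:E.

Let mT : measurable ([set: V] `*` Omega).
Proof. by apply: measurableX => //; exact: open_measurable_rV. Qed.

Let tube_density0 : tube_density set0 = 0.
Proof. by rewrite /tube_density set0I integral_set0. Qed.

Let tube_density_ge0 A : 0 <= tube_density A.
Proof. by apply: integral_ge0 => z [_ [_ ?]]; rewrite lee_fin phi_ge0. Qed.

Let mphi2 : measurable_fun ([set: V] `*` Omega) (fun z => (phi z.2)%:E).
Proof.
apply/measurable_EFinP.
apply: (@measurable_comp _ _ _ _ _ _ Omega) => //.
- exact: open_measurable_rV.
- by move=> _ [z [_ ?] <-].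
- exact: measurable_funTS.
Qed.

Let tube_density_sigma_additive : semi_sigma_additive tube_density.
Proof.
move=> F mF tF mUF; rewrite /tube_density setI_bigcupl.
rewrite ge0_integral_bigcup/=.
- apply: is_cvg_ereal_nneg_natsum_cond => k _ _; exact: tube_density_ge0.
- by move=> k; exact: measurableI.
- apply: measurable_funS mphi2 => //.
  by rewrite -setI_bigcupl; exact: subIsetr.
- by move=> z [k _ [_ [_ ?]]]; rewrite lee_fin phi_ge0.
- exact: trivIset_setIr.
Qed.

Definition tube_measure : {measure set (V * V)%type -> \bar R} :=
  HB.pack_for {measure set (V * V)%type -> \bar R} tube_density
    (isMeasure.Build _ _ _ tube_density tube_density0 tube_density_ge0
       tube_density_sigma_additive).

End tube_measure.

End tube.

(* Main.v *)
Require Import Defs.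
From HB Require Import structures.
From mathcomp Require Import all_boot all_order all_algebra.
From mathcomp Require Import all_classical all_reals all_analysis.
From mathcomp Require Import measurable_realfun complex ring lra.
From mathcomp Require mpoly.

Set Implicit Arguments.
Unset Strict Implicit.
Unset Printing Implicit Defensive.

Import Order.TTheory GRing.Theory Num.Theory.
Import numFieldNormedType.Exports.

Local Open Scope classical_set_scope.
Local Open Scope ring_scope.

(** The link between the four conditions is the integral of phi over the part of
the cone of size s: each of them bounds it independently of s.

The determinant inequalities only depend on three facts: Delta is positive on
Omega, it increases with respect to the cone ([determinant_le]), and
Delta (s e) = s^r.  The exponent g = - 2 alpha + n / r is negative, as r <= n.
Hence Delta (y + t) ^ g <= Delta t ^ g, and integrability of phi gives the
inequality for all alpha.  Conversely, if y is small compared to s then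
y + s e <= 2 s e, so that Delta (y + s e) ^ g is at least a constant times
Delta (s e) ^ g, and the inequality at t = s e bounds the integral of phi over
these y ([integrable_of_determinant_bound]).

If phi is integrable, Tonelli gives the Carleson inequality.  For the converse,
the inequality is applied to a product of Cauchy kernels.  Squares satisfy
|y_i| <= K <y, e> for some K, because <a^2, e> = <a, a>; put l = K <., e> and
l_i = l + x_i, which are nonnegative on Omega.  The function
    F (z) = prod_i 1 / ((l (z) + i s) (l_i (z) + i s))
is holomorphic on the tube.  As x_i is the difference of l_i and l, one has
|F (x + i y)|^2 <= prod_i 2 / (s^2 (s^2 + x_i^2)), whose integral in x is a
constant times s^(- 3 n); and |F|^2 is at least a constant times s^(- 4 n) when
x and y have size s, so that the integral in x is then also at least a constant
times s^(- 3 n).  The Carleson inequality for F therefore bounds the integral of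
phi over the part of Omega of size s ([integrable_of_carleson]).

It remains to see why Delta increases.  Multiplication by a regular element x is
self-adjoint, so the minimal polynomial of x has simple real roots l_i, and
x = sum_i l_i c_i for a frame of orthogonal idempotents c_i; then
Delta x = prod_i l_i.  Let t = sum_j l_j c_j and z = sum_i k_i d_i be regular
with z - t a square.  The numbers <d_i, c_j> are nonnegative, and the row and
column sums of this matrix are the |d_i|^2 and the |c_j|^2.  If these are all
equal, Jensen's inequality for the logarithm shows that
prod_j l_j <= prod_i k_i ([determinant_le_regular]).

That all idempotents of all frames have the same length is where simplicity
enters ([frame_norm]).  Let <v, .> be the differential of Delta at e, that is the
trace: <v, c_i> = 1 for every frame.  The reflection attached to an idempotent c,
which is -1 on the 1/2-eigenspace of c and 1 on the others, is an automorphism and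
preserves Delta; so v is orthogonal to the 1/2-eigenspaces, which implies that v
commutes with the elements of all frames.  Thus v is central, and as eigenspaces
of a central element are ideals, v = a e.  Finally 1 = <v, c_i> = a |c_i|^2.

Elements that are not regular are reached along lines: Delta is a polynomial, and
the non-regular points of a line through a regular one are the zeros of a nonzero
polynomial, a Gram determinant ([regular_line]). *)

(** * The Jordan identity and its linearizations *)

(** Outermost products become unknown vectors, so that comparing entries leaves
a goal of linear arithmetic with small atoms. *)
Ltac generalize_products := repeat match goal with
  |- context [@jmul ?R ?n ?J ?a ?b] =>
    let t := fresh "t" in generalize (@jmul R n J a b); intro t end.

Section jordan_identities.
Variables (R : realType) (m : nat) (J : euclidean_jordan_algebra R m.+1).
Local Notation V := 'rV[R]_m.+1.
Local Notation "x ** y" := (jmul J x y) (at level 40, left associativity).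
Local Notation dot := (jdot J).
Local Notation e := (jone J).

HB.instance Definition _ (a : V) :=
  GRing.isLinear.Build R V V _ (jmul J a) (@jmul_linear R m.+1 J a).
HB.instance Definition _ (a : V) :=
  GRing.isLinear.Build R V R _ (jdot J a) (@jdot_linear R m.+1 J a).

Lemma jmulDl (x y z : V) : (x + y) ** z = x ** z + y ** z.
Proof. by rewrite !(jmulC _ _ z) linearD. Qed.

Lemma jmulDr (x y z : V) : x ** (y + z) = x ** y + x ** z.
Proof. exact: linearD. Qed.

Lemma jmulZr (a : R) (x z : V) : x ** (a *: z) = a *: (x ** z).
Proof. exact: linearZ. Qed.

Lemma jmulNr (x z : V) : x ** (- z) = - (x ** z).
Proof. exact: linearN. Qed.

Lemma jmulZl (a : R) (x z : V) : (a *: x) ** z = a *: (x ** z).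
Proof. by rewrite !(jmulC _ _ z) linearZ. Qed.

Lemma jmulNl (x z : V) : (- x) ** z = - (x ** z).
Proof. by rewrite !(jmulC _ _ z) linearN. Qed.

Lemma jmul0l (z : V) : 0 ** z = 0.
Proof. by rewrite jmulC linear0. Qed.

Lemma jmulr1 (x : V) : x ** e = x.
Proof. by rewrite jmulC jmul1. Qed.

Lemma jmul_suml (I : Type) (s : seq I) (P : pred I) (F : I -> V) (z : V) :
  (\sum_(i <- s | P i) F i) ** z = \sum_(i <- s | P i) F i ** z.
Proof.
by rewrite jmulC linear_sum; apply: eq_bigr => i _; rewrite jmulC.
Qed.

Lemma jdotDl (x y z : V) : dot (x + y) z = dot x z + dot y z.
Proof. by rewrite !(jdotC _ _ z) linearD. Qed.

Lemma jdotZl (a : R) (x z : V) : dot (a *: x) z = a * dot x z.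
Proof. by rewrite !(jdotC _ _ z) linearZ. Qed.

Lemma jdotNl (x z : V) : dot (- x) z = - dot x z.
Proof. by rewrite !(jdotC _ _ z) linearN. Qed.

Lemma jdotDr (x y z : V) : dot x (y + z) = dot x y + dot x z.
Proof. exact: linearD. Qed.

Lemma jdotZr (a : R) (x z : V) : dot x (a *: z) = a * dot x z.
Proof. exact: linearZ. Qed.

Lemma jdotNr (x z : V) : dot x (- z) = - dot x z.
Proof. exact: linearN. Qed.

Lemma jdot0r (x : V) : dot x 0 = 0.
Proof. exact: linear0. Qed.

Lemma jdot_suml (I : Type) (s : seq I) (P : pred I) (F : I -> V) (z : V) :
  dot (\sum_(i <- s | P i) F i) z = \sum_(i <- s | P i) dot (F i) z.
Proof. by rewrite jdotC linear_sum; apply: eq_bigr => i _; rewrite jdotC. Qed.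

Lemma jdot_ge0 (x : V) : 0 <= dot x x.
Proof.
by have [->|/(jdot_gt0 J)/ltW //] := eqVneq x 0; rewrite linear0.
Qed.

Lemma jdot_eq0 (x : V) : dot x x = 0 -> x = 0.
Proof. by have [//|/(jdot_gt0 J)] := eqVneq x 0; move=> /[swap] ->;
  rewrite ltxx. Qed.

Lemma jdot_sqr (x : V) : dot (x ** x) e = dot x x.
Proof. by rewrite jdot_associative jmulr1. Qed.

Lemma jone_neq0 : e != 0.
Proof.
apply/eqP => e0; have /eqP := jmul1 J (const_mx 1 : V).
rewrite e0 jmul0l => /eqP/rowP/(_ ord0); rewrite !mxE => /eqP.
by rewrite eq_sym oner_eq0.
Qed.

(** The terms of the Jordan identity that are linear in z, once x is replaced by
x + z: they are half the difference of the identities at x + z and x - z, up to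
the identity at z. *)
Lemma jordan_linearized (x y z : V) :
  z ** ((x ** x) ** y) + 2 *: (x ** ((x ** z) ** y)) =
  2 *: ((x ** z) ** (x ** y)) + (x ** x) ** (z ** y).
Proof.
have h1 := jordan_identity J (x + z) y.
have h2 := jordan_identity J (x - z) y.
have h3 := jordan_identity J z y.
move: h1 h2 h3.
rewrite !(jmulDl, jmulDr, jmulNl, jmulNr).
rewrite !(jmulC _ z x).
generalize_products => /rowP h1 /rowP h2 /rowP h3.
apply/rowP => i; move: (h1 i) (h2 i) (h3 i).
by rewrite !mxE; lra.
Qed.

Lemma jordan_commutator (x y z : V) :
  z ** ((x ** x) ** y) - (x ** x) ** (z ** y) =
  2 *: ((x ** z) ** (x ** y) - x ** ((x ** z) ** y)).
Proof.
have := jordan_linearized x y z; generalize_products => /rowP h.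
by apply/rowP => i; move: (h i); rewrite !mxE; lra.
Qed.

(** Multiplication operators as matrices acting on row vectors on the right, so
that polynomials in an operator are available. *)
Definition jL (a : V) : 'M[R]_m.+1 := lin1_mx (jmul J a).

Lemma mul_jL (v a : V) : v *m jL a = a ** v.
Proof. by rewrite /jL mul_rV_lin1. Qed.

Lemma eq_mx_rV (A B : 'M[R]_m.+1) : (forall v : V, v *m A = v *m B) -> A = B.
Proof. by move=> h; apply/row_matrixP => i; rewrite !rowE. Qed.

Lemma jLZ (k : R) (a : V) : jL (k *: a) = k *: jL a.
Proof. by apply: eq_mx_rV => v; rewrite -scalemxAr !mul_jL jmulZl. Qed.

Lemma jL_sum (I : Type) (s : seq I) (P : pred I) (F : I -> V) :
  jL (\sum_(i <- s | P i) F i) = \sum_(i <- s | P i) jL (F i).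
Proof.
apply: eq_mx_rV => v; rewrite mulmx_sumr mul_jL jmul_suml.
by apply: eq_bigr => i _; rewrite mul_jL.
Qed.

Lemma jL1 : jL e = 1.
Proof. by apply: eq_mx_rV => v; rewrite mul_jL jmul1 mulmx1. Qed.

Lemma mulmx_mul (v : V) (A B : 'M[R]_m.+1) : v *m (A * B) = v *m A *m B.
Proof. by rewrite -mulmxA. Qed.

(** The linearized identity as an identity between operators on z: the operator
of x^2 y lies in the algebra generated by those of x, y, x^2 and x y. *)
Lemma jL_sqr_mul (x y : V) :
  jL ((x ** x) ** y) =
  jL y * jL (x ** x) + 2 *: (jL x * jL (x ** y) - jL x * jL y * jL x).
Proof.
apply: eq_mx_rV => z; rewrite mulmxDr -scalemxAr mulmxBr !mulmx_mul !mul_jL.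
have := jordan_linearized x y z;
  rewrite !(jmulC _ y) (jmulC _ z ((x ** x) ** y)).
rewrite (jmulC _ (x ** z) (x ** y)) (jmulC _ z y).
generalize_products => /rowP h.
by apply/rowP => i; move: (h i); rewrite !mxE; lra.
Qed.

Lemma jpowE (x : V) k : jpow J x k = e *m jL x ^+ k.
Proof.
elim: k => [|k IH]; first by rewrite expr0 mulmx1.
by rewrite exprSr mulmx_mul -IH mul_jL.
Qed.

Lemma comm_jL_sqr (x : V) : GRing.comm (jL x) (jL (x ** x)).
Proof.
apply: eq_mx_rV => v; rewrite !mulmx_mul !mul_jL.
by rewrite jordan_identity.
Qed.

(** As x^(k+2) = x^2 x^k, the operator of x^(k+2) is expressed through those
of x, x^2, x^k and x^(k+1), which commute with that of x. *)
Lemma comm_jL_jpow (x : V) k : GRing.comm (jL x) (jL (jpow J x k)).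
Proof.
suff : GRing.comm (jL x) (jL (jpow J x k)) /\
       GRing.comm (jL x) (jL (jpow J x k.+1)) by case.
elim: k => [|k [IH1 IH2]].
  rewrite /= jmulr1; split => //.
  by rewrite /jpow /= jL1; apply: commr1.
split=> //.
have -> : jpow J x k.+2 = (x ** x) ** jpow J x k.
  rewrite !jpowE -mul_jL -mulmx_mul.
  have -> : jL x ^+ k * jL (x ** x) = jL (x ** x) * jL x ^+ k.
    by apply/esym/commrX/commr_sym/comm_jL_sqr.
  by rewrite mulmx_mul !mul_jL jmulr1 -addn2 addnC exprD mulmx_mul expr2
    mulmx_mul !mul_jL jmulr1.
rewrite jL_sqr_mul; apply: commrD; first exact: commrM IH1 (comm_jL_sqr x).
by rewrite /GRing.comm -scalerAr -scalerAl; congr (_ *: _);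
   apply: commrB; [apply: commrM|apply: commrM => //; apply: commrM].
Qed.

End jordan_identities.

(** * Power associativity and the spectral theorem *)

Section spectral.
Variables (R : realType) (m : nat) (J : euclidean_jordan_algebra R m.+1).
Local Notation V := 'rV[R]_m.+1.
Local Notation "x ** y" := (jmul J x y) (at level 40, left associativity).
Local Notation dot := (jdot J).
Local Notation e := (jone J).
Local Notation jL := (jL J).

(** The powers of x are the orbit of e under multiplication by x, so the minimal
polynomial of x is the one of the vector e for this operator. *)
Lemma jevalE (q : {poly R}) (x : V) : jeval J q x = e *m horner_mx (jL x) q.
Proof.
rewrite -[in RHS](coefK q) poly_def rmorph_sum mulmx_sumr.
apply: eq_bigr => i _ /=; rewrite horner_mxZ rmorphXn /= horner_mx_X.
by rewrite -scalemxAr -jpowE.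
Qed.

Lemma jeval_mulmx (p q : {poly R}) (x : V) :
  jeval J (p * q) x = jeval J p x *m horner_mx (jL x) q.
Proof. by rewrite !jevalE rmorphM mulmx_mul. Qed.

Lemma jevalD (p q : {poly R}) (x : V) :
  jeval J (p + q) x = jeval J p x + jeval J q x.
Proof. by rewrite !jevalE rmorphD mulmxDr. Qed.

Lemma jevalN (p : {poly R}) (x : V) : jeval J (- p) x = - jeval J p x.
Proof. by rewrite !jevalE rmorphN mulmxN. Qed.

Lemma jevalZ (a : R) (p : {poly R}) (x : V) :
  jeval J (a *: p) x = a *: jeval J p x.
Proof. by rewrite !jevalE horner_mxZ -scalemxAr. Qed.

Lemma jeval0 (x : V) : jeval J 0 x = 0.
Proof. by rewrite jevalE rmorph0 mulmx0. Qed.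

Lemma jeval1 (x : V) : jeval J 1 x = e.
Proof. by rewrite jevalE rmorph1 mulmx1. Qed.

Lemma jevalX (x : V) : jeval J 'X x = x.
Proof. by rewrite jevalE horner_mx_X mul_jL jmulr1. Qed.

Lemma jeval_sum (I : finType) (F : I -> {poly R}) (x : V) :
  jeval J (\sum_i F i) x = \sum_i jeval J (F i) x.
Proof. by rewrite jevalE rmorph_sum mulmx_sumr; apply: eq_bigr => i _;
  rewrite jevalE. Qed.

Lemma comm_jL_jeval (q : {poly R}) (x : V) :
  GRing.comm (jL (jeval J q x)) (jL x).
Proof.
rewrite /jeval jL_sum; apply/commr_sym/commr_sum => i _.
by rewrite jLZ /GRing.comm -scalerAr -scalerAl comm_jL_jpow.
Qed.

(** Power associativity: multiplication by p(x) commutes with that by x, hence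
with that by q(x), and it sends e to p(x). *)
Lemma jevalM (p q : {poly R}) (x : V) :
  jeval J (p * q) x = jeval J p x ** jeval J q x.
Proof.
rewrite jeval_mulmx (jevalE q) -mul_jL.
rewrite -mulmx_mul [_ * _](comm_horner_mx q (commr_sym (comm_jL_jeval p x))).
by rewrite mulmxA mul_jL jmulr1.
Qed.

Lemma jdot_jL (v w a : V) : dot (v *m jL a) w = dot v (w *m jL a).
Proof. by rewrite !mul_jL jdot_associative. Qed.

Lemma jdot_horner (q : {poly R}) (v w a : V) :
  dot (v *m horner_mx (jL a) q) w = dot v (w *m horner_mx (jL a) q).
Proof.
elim/poly_ind: q v w => [|q c IH] v w.
  by rewrite rmorph0 !mulmx0 linear0 jdotC linear0.
rewrite rmorphD rmorphM /= horner_mx_X horner_mx_C !mulmxDr jdotDl linearD /=.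
rewrite !mul_mx_scalar jdotZl linearZ /=; congr (_ + _).
rewrite mulmx_mul jdot_jL IH -!mulmx_mul; congr (dot _ (_ *m _)).
exact: (comm_mx_horner q (comm_mx_refl (jL a))).
Qed.

Lemma minimal_polynomial_exists (x : V) : exists p, minimal_polynomial J x p.
Proof.
pose P k := `[< exists q : {poly R}, [/\ q != 0,
  jeval J q x = 0 & size q = k] >].
have exP : exists k, P k.
  exists (size (char_poly (jL x))); apply/asboolP; exists (char_poly (jL x)).
  by rewrite monic_neq0 ?char_poly_monic// jevalE Cayley_Hamilton mulmx0.
case: (ex_minnP exP) => k /asboolP[q [q0 qx <-]] kmin.
exists ((lead_coef q)^-1 *: q); split.
- by rewrite monicE lead_coefZ mulVf ?lead_coef_eq0.
- by rewrite jevalZ qx scaler0.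
- move=> g g0 gx; rewrite size_scale ?invr_eq0 ?lead_coef_eq0//.
  by apply: kmin; apply/asboolP; exists g.
Qed.

Lemma size_minimal_polynomial (x : V) p : minimal_polynomial J x p ->
  (size p <= m.+2)%N.
Proof.
move=> [_ _ pmin]; rewrite -(size_char_poly (jL x)); apply: pmin.
  by rewrite monic_neq0 ?char_poly_monic.
by rewrite jevalE Cayley_Hamilton mulmx0.
Qed.

(** A complex root a + ib of q is not real, so that q is divisible by the minimal
polynomial of a + ib over the reals. *)
Lemma quadratic_factor (q : {poly R}) : (1 < size q)%N ->
  (forall a, ~~ root q a) ->
  exists a b : R, b != 0 /\ ('X - a%:P) ^+ 2 + (b ^+ 2)%:P %| q.
Proof.
move=> q1 nroot.
pose f : {rmorphism R -> R[i]} := real_complex R.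
have /closed_rootP[z] : size (map_poly f q) != 1%N.
  by rewrite size_map_poly neq_ltn q1 orbT.
case: z => a b rz; exists a, b.
pose d : {poly R} := ('X - a%:P) ^+ 2 + (b ^+ 2)%:P.
have sd : size d = 3%N.
  rewrite /d size_polyDl size_exp_XsubC// size_polyC.
  by case: (_ != 0).
have b0 : b != 0.
  apply/eqP => b0; have := nroot a; rewrite -(fmorph_root f).
  by move: rz; rewrite b0 /= => ->.
split=> //.
have d0 : d != 0 by rewrite -size_poly_gt0 sd.
rewrite -/d /dvdp -/(_ %% _).
have : root (map_poly f (q %% d)) (a +i* b)%C.
  have := rz; rewrite {1}(divp_eq q d) rmorphD rmorphM /= /root hornerD hornerM.
  suff -> : (map_poly f d).[(a +i* b)%C] = 0 by rewrite mulr0 add0r.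
  rewrite /d rmorphD /= rmorphXn /= rmorphB /= map_polyX !map_polyC /=.
  rewrite !hornerE /= /f /=; apply/eqP; rewrite eq_complex /=.
  by rewrite !expr2 /=; apply/andP; split; apply/eqP; ring.
have sr : (size (q %% d)%R <= 2)%N by rewrite -ltnS -sd ltn_modp.
have -> : q %% d = ((q %% d)`_0)%:P + (q %% d)`_1 *: 'X.
  apply/polyP => -[|[|k]]; rewrite !coefE /= ?mulr0 ?mulr1 ?addr0 ?add0r//.
  by rewrite nth_default// (leq_trans sr).
move: (_`_0) (_`_1) => u v.
rewrite rmorphD /= map_polyC /= map_polyZ map_polyX /root !hornerE /=
  eq_complex /=.
move=> /andP[/eqP h1 /eqP h2].
have v0 : v = 0.
  by apply: (mulIf b0); rewrite mul0r; move: h2; lra.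
have u0 : u = 0 by move: h1; rewrite v0; lra.
by rewrite u0 v0 polyC0 scale0r addr0.
Qed.

Lemma split_real_roots (p : {poly R}) : p != 0 ->
  exists (s : seq R) q, p = q * \prod_(a <- s) ('X - a%:P) /\
    forall a, ~~ root q a.
Proof.
have [k] := ubnP (size p); elim: k p => // k IH p pk p0.
have [[a /factor_theorem[q pq]]|nr] := pselect (exists a, root p a).
  have q0 : q != 0 by apply: contraNneq p0 => q0; rewrite pq q0 mul0r.
  have [|//|s [g [qg ng]]] := IH q.
    by move: pk; rewrite pq size_Mmonic ?monicXsubC// size_XsubC addn2.
  by exists (a :: s), g; rewrite big_cons pq qg [RHS]mulrCA [RHS]mulrC.
exists [::], p; rewrite big_nil mulr1; split=> // a; apply/negP => ra.
by apply: nr; exists a.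
Qed.

(** Multiplication by x is self-adjoint.  So ((L - a)^2 + b^2) u = 0 implies
|(L - a) u|^2 + b^2 |u|^2 = 0, and (L - a)^2 u = 0 implies (L - a) u = 0: a
quadratic factor or a double root would contradict minimality. *)
Lemma minimal_polynomial_split (x : V) p : minimal_polynomial J x p ->
  exists s : seq R, uniq s /\ p = \prod_(a <- s) ('X - a%:P).
Proof.
move=> [pmon px pmin].
have p0 := monic_neq0 pmon.
have nz (d g : {poly R}) : p = g * d -> (1 < size d)%N -> jeval J g x != 0.
  move=> pgd d1; apply/eqP => gx.
  have g0 : g != 0 by apply: contraNneq p0 => g0; rewrite pgd g0 mul0r.
  have := pmin _ g0 gx; rewrite pgd size_mul//; last first.
    by rewrite -size_poly_gt0 (leq_trans _ d1).
  by rewrite -subn1 leqNgt -addnBA ?(ltnW d1)// -{1}(addn0 (size g)) ltn_add2l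
    subn_gt0 d1.
have [s [q [pq nq]]] := split_real_roots p0.
have q1 : size q = 1%N.
  apply/eqP; rewrite eqn_leq size_poly_gt0; apply/andP; split; last first.
    by apply: contraNneq p0 => q0; rewrite pq q0 mul0r.
  rewrite leqNgt; apply/negP => q1.
  have [a [b [b0 /dvdpP[g qg]]]] := quadratic_factor q1 nq.
  set d := _ + _ in qg.
  have /nz : p = (g * \prod_(a <- s) ('X - a%:P)) * d by rewrite pq qg mulrAC.
  have -> : size d = 3%N.
    by rewrite /d size_polyDl size_exp_XsubC// size_polyC; case: (_ != 0).
  move=> /(_ isT)/eqP; apply; set h := g * _; apply: (jdot_eq0 (J := J)).
  set u := jeval J h x.
  have : dot (u *m horner_mx (jL x) d) u = 0.
    rewrite -jeval_mulmx /h mulrAC -qg -pq px jdotC linear0 //.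
  rewrite /d rmorphD /= horner_mx_C mulmxDr jdotDl rmorphXn /= expr2 mulmx_mul.
  rewrite jdot_horner mul_mx_scalar jdotZl => /eqP.
  rewrite paddr_eq0 ?jdot_ge0 ?(mulr_ge0 (sqr_ge0 b)) ?jdot_ge0// => /andP[_].
  by rewrite mulf_eq0 sqrf_eq0 (negbTE b0) => /eqP.
have pE : p = \prod_(a <- s) ('X - a%:P).
  have /size_poly1P[c c0 qc] : size q == 1%N by rewrite q1.
  move: pmon; rewrite pq qc mul_polyC monicE lead_coefZ.
  rewrite (monicP (monic_prod_XsubC _ _ _)) mulr1 => /eqP ->.
  by rewrite scale1r.
exists s; split=> //; apply: count_mem_uniq => a.
have [as_|/count_memPn //] := boolP (a \in s).
have ps := perm_to_rem as_; rewrite (permP ps) /= eqxx.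
suff /count_memPn -> : a \notin rem a s by [].
apply/negP => ar; have pr := perm_to_rem ar.
pose g := \prod_(b <- rem a (rem a s)) ('X - b%:P).
have pg : p = g * ('X - a%:P) * ('X - a%:P).
  by rewrite pE (perm_big _ ps) big_cons (perm_big _ pr) big_cons
    [LHS]mulrA [LHS]mulrC [LHS]mulrA.
have /nz := pg; rewrite size_XsubC => /(_ isT)/eqP; apply;
  apply: (jdot_eq0 (J := J)).
by rewrite jeval_mulmx jdot_horner -!jeval_mulmx -pg px linear0.
Qed.

End spectral.

Section frames.
Variables (R : realType) (m : nat) (J : euclidean_jordan_algebra R m.+1).
Local Notation V := 'rV[R]_m.+1.
Local Notation "x ** y" := (jmul J x y) (at level 40, left associativity).
Local Notation dot := (jdot J).
Local Notation e := (jone J).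

(** Complete systems of orthogonal idempotents; those of length the rank are
the Jordan frames. *)
Definition jordan_frame r (c : 'I_r -> V) :=
  [/\ forall i j, c i ** c j = (i == j)%:R *: c i,
      forall i, c i != 0 & \sum_i c i = e].

Section frame_theory.
Variables (r : nat) (c : 'I_r -> V).
Hypothesis cP : jordan_frame c.

Lemma frame_idem i : c i ** c i = c i.
Proof. by have [+ _ _] := cP => ->; rewrite eqxx scale1r. Qed.

Lemma frame_orth i j : i != j -> dot (c i) (c j) = 0.
Proof.
have [cc _ _] := cP => ij.
by rewrite -(frame_idem i) jdot_associative cc (negbTE ij) scale0r linear0.
Qed.

Lemma frame_gt0 i : 0 < dot (c i) (c i).
Proof. by have [_ c0 _] := cP; exact: jdot_gt0. Qed.

Lemma frame_dot_sum (l : 'I_r -> R) i :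
  dot (\sum_j l j *: c j) (c i) = l i * dot (c i) (c i).
Proof.
rewrite jdot_suml (bigD1 i)//= jdotZl big1 ?addr0// => j ji.
by rewrite jdotZl frame_orth// mulr0.
Qed.

Lemma frame_mul_sum (l : 'I_r -> R) i :
  (\sum_j l j *: c j) ** c i = l i *: c i.
Proof.
have [cc _ _] := cP; rewrite jmul_suml (bigD1 i)//= jmulZl frame_idem.
rewrite big1 ?addr0// => j /negbTE ji.
by rewrite jmulZl cc ji scale0r scaler0.
Qed.

Lemma jeval_frame (q : {poly R}) (l : 'I_r -> R) :
  jeval J q (\sum_i l i *: c i) = \sum_i q.[l i] *: c i.
Proof.
set x := \sum_i _; elim/poly_ind: q => [|q a IH].
  by rewrite jeval0 big1// => i _; rewrite horner0 scale0r.
rewrite jevalD jevalM jevalX IH jmulC linear_sum -[a%:P]alg_polyC jevalZ jeval1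
  /=.
have [_ _ <-] := cP; rewrite scaler_sumr -big_split; apply: eq_bigr => i _ /=.
rewrite linearZ /= frame_mul_sum scalerA -scalerDl.
by rewrite alg_polyC hornerMXaddC.
Qed.

Lemma frame_minimal_polynomial (l : 'I_r -> R) : injective l ->
  minimal_polynomial J (\sum_i l i *: c i) (\prod_i ('X - (l i)%:P)).
Proof.
move=> linj; split; first exact: monic_prod_XsubC.
  rewrite jeval_frame big1// => i _; rewrite horner_prod (bigD1 i)//=.
  by rewrite hornerXsubC subrr mul0r scale0r.
move=> q q0; rewrite jeval_frame => qx.
have ql i : root q (l i).
  have := congr1 (dot^~ (c i)) qx; rewrite frame_dot_sum jdotC linear0.
  by move=> /eqP; rewrite mulf_eq0 (gt_eqF (frame_gt0 i)) orbF.
rewrite size_prod_XsubC -(size_map l); apply: max_poly_roots => //.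
  by apply/allP => _ /mapP[i _ ->].
by rewrite map_inj_uniq ?index_enum_uniq.
Qed.

End frame_theory.

(** Spectral theorem: the c_i are the Lagrange interpolation polynomials at the
roots of the minimal polynomial, evaluated at x. *)
Lemma frame_of_minimal_polynomial (x : V) p r :
  minimal_polynomial J x p -> size p = r.+1 ->
  exists (l : 'I_r -> R) (c : 'I_r -> V),
    [/\ injective l, jordan_frame c & x = \sum_i l i *: c i].
Proof.
move=> px sp; have [s [us pE]] := minimal_polynomial_split px.
have ss : size s = r by apply: succn_inj; rewrite -sp pE size_prod_XsubC.
pose l (i : 'I_r) := s`_i.
have linj : injective l.
  move=> i j /eqP; rewrite /l nth_uniq ?ss// => /eqP ij; exact: val_inj.
(* Evaluation at x only depends on the values at the roots of p. *)
have jv (q : {poly R}) : (forall i, q.[l i] = 0) -> jeval J q x = 0.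
  move=> ql; have /dvdpP[g qE] : p %| q.
    rewrite pE uniq_roots_dvdp ?uniq_rootsE//; apply/allP => a a_s.
    by have [i + <-] := nthP 0 a_s; rewrite ss => ir;
      rewrite /root (ql (Ordinal ir)).
  by rewrite qE (jevalM J g p); case: px => _ -> _; rewrite linear0.
have jvE (q g : {poly R}) : (forall i,
  q.[l i] = g.[l i]) -> jeval J q x = jeval J g x.
  move=> qg; apply/eqP; rewrite -subr_eq0 -jevalN -jevalD; apply/eqP/jv => i.
  by rewrite hornerD hornerN qg subrr.
pose w i := \prod_(j | j != i) ('X - (l j)%:P).
have wii i : (w i).[l i] != 0.
  rewrite horner_prod; apply/prodf_neq0 => j ji; rewrite hornerXsubC subr_eq0.
  by rewrite (inj_eq linj) eq_sym.
pose u i := (w i).[l i]^-1 *: w i.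
have uE i j : (u i).[l j] = (i == j)%:R.
  rewrite hornerZ; have [<-|ij] := eqVneq i j; first by rewrite mulVf.
  rewrite [X in _ * X]horner_prod (bigD1 j) /=; last by rewrite eq_sym.
  by rewrite [X in _ * (X * _)]hornerXsubC subrr mul0r mulr0.
exists l, (fun i => jeval J (u i) x); split=> //; last first.
  rewrite -[LHS](jevalX J).
  transitivity (jeval J (\sum_i l i *: u i) x).
    apply: jvE => j; rewrite hornerX horner_sum
      (bigD1 j)//= hornerZ uE eqxx mulr1.
    by rewrite big1 ?addr0// => i ij; rewrite hornerZ uE (negbTE ij) mulr0.
  by rewrite jeval_sum; apply: eq_bigr => i _; rewrite jevalZ.
split=> [i j|i|].
- rewrite -jevalM -jevalZ; apply: jvE => k; rewrite hornerM !uE hornerZ uE.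
  have [<-|ij] := eqVneq i j; first by rewrite -!natrM !mulnb andbb.
  rewrite mul0r; have [<-|_] := eqVneq i k; last by rewrite mul0r.
  by rewrite eq_sym (negbTE ij) mulr0.
- apply/eqP => ui0; have wx : jeval J (w i) x = 0.
    rewrite -[w i](scale1r) -(mulfV (wii i)) -scalerA jevalZ.
    by rewrite -/(u i) ui0 scaler0.
  case: px => _ _ /(_ (w i)).
  have -> : w i != 0 by apply/eqP => w0; move: (wii i); rewrite w0 horner0 eqxx.
  move=> /(_ isT wx); rewrite sp.
  have -> : w i = \prod_(j <- enum (predC1 i)) ('X -
    (l j)%:P) by rewrite big_enum.
  by rewrite size_prod_XsubC -cardE cardC1 card_ord (ltn_predK
    (ltn_ord i)) ltnn.
- rewrite -jeval_sum -(jeval1 J x); apply: jvE => j.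
  rewrite hornerC horner_sum (bigD1 j)//= uE eqxx big1 ?addr0// => i ij.
  by rewrite uE (negbTE ij).
Qed.

End frames.

(** * Peirce reflections *)

Section idempotents.
Variables (R : realType) (m : nat) (J : euclidean_jordan_algebra R m.+1).
Local Notation V := 'rV[R]_m.+1.
Local Notation "x ** y" := (jmul J x y) (at level 40, left associativity).
Local Notation dot := (jdot J).
Local Notation e := (jone J).

Variable c : V.
Hypothesis cc : c ** c = c.

Lemma idem_cube (z : V) : 2 *: (c ** (c ** (c ** z))) = 3 *: (c **
  (c ** z)) - c ** z.
Proof.
have := jordan_commutator J c c z; rewrite !cc !(jmulC _ _ c).
generalize_products => /rowP h; apply/rowP => i; move: (h i); rewrite !mxE; lra.
Qed.

(** On the eigenvalues 0, 1/2, 1 of multiplication by c one has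
u = u^2 + 4 (u - u^2)^2, so that <c a, a> = |b|^2 + 4 |b - d|^2 with b = c a and
d = c b. *)
Lemma idem_dot_sqr_ge0 (a : V) : 0 <= dot (a ** a) c.
Proof.
rewrite jdot_associative (jmulC _ a c).
set b := c ** a; set d := c ** b.
have cd : 2 *: (c ** d) = 3 *: d - b by exact: idem_cube.
have ccd : 4 *: (c ** (c ** d)) = 7 *: d - 3 *: b.
  have := idem_cube b; rewrite -/d => h; move: cd h.
  generalize_products => /rowP h1 /rowP h2.
  by apply/rowP => i; move: (h1 i) (h2 i); rewrite !mxE; lra.
have bb : dot b b = dot a d by rewrite /b jdot_associative.
have bd : 2 * dot b d = 3 * dot a d - dot a b.
  by rewrite {1}/b jdot_associative -jdotZr cd jdotDr jdotNr jdotZr.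
have dd : 4 * dot d d = 7 * dot a d - 3 * dot a b.
  rewrite {1}/d jdot_associative {1}/b jdot_associative -jdotZr ccd.
  by rewrite jdotDr jdotNr !jdotZr.
have : 0 <= dot (b - d) (b - d) by exact: jdot_ge0.
have : 0 <= dot b b by exact: jdot_ge0.
rewrite !(jdotDl, jdotNl, jdotDr, jdotNr) (jdotC _ d b).
lra.
Qed.

(** Multiplication by c has the eigenvalues 0, 1/2 and 1.  Even vectors are
the sums of eigenvectors for 0 and 1, odd ones are eigenvectors for 1/2. *)
Definition idem_even (a : V) := c ** (c ** a) = c ** a.
Definition idem_odd (a : V) := c ** a = 2^-1 *: a.
Definition odd_part (a : V) : V := 4 *: (c ** a - c ** (c ** a)).

Lemma odd_partP (a : V) : idem_odd (odd_part a).
Proof.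
rewrite /idem_odd /odd_part jmulZr jmulDr jmulNr.
have := idem_cube a; generalize_products => /rowP h.
by apply/rowP => i; move: (h i); rewrite !mxE; lra.
Qed.

Lemma even_partP (a : V) : idem_even (a - odd_part a).
Proof.
rewrite /idem_even !(jmulDr, jmulNr) !odd_partP jmulZr odd_partP /odd_part.
generalize_products.
by apply/rowP => i; rewrite !mxE; lra.
Qed.

(** The commutator of the multiplications by c and a is twice that of c and
c a; as c (c a) = c a, the latter is twice itself, hence both vanish. *)
Lemma even_comm (a y : V) : idem_even a -> c ** (a ** y) = a ** (c ** y).
Proof.
move=> ca; have := jordan_commutator J c y a;
  have := jordan_commutator J c y (c ** a).
rewrite cc ca; generalize_products => /rowP h1 /rowP h2.
by apply/rowP => i; move: (h1 i) (h2 i); rewrite !mxE; lra.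
Qed.

Lemma even_even (a b : V) : idem_even a -> idem_even b -> idem_even (a ** b).
Proof. by move=> ea eb; rewrite /idem_even !even_comm// eb. Qed.

Lemma even_odd (a b : V) : idem_even a -> idem_odd b -> idem_odd (a ** b).
Proof. by move=> ea ob; rewrite /idem_odd even_comm// ob jmulZr. Qed.

(** The Jordan identity at u linearized in the direction c, applied to c. *)
Lemma odd_sqr (u : V) : idem_odd u -> idem_even (u ** u).
Proof.
move=> ou; have := jordan_linearized J u c c.
rewrite cc !(jmulC _ _ c) ou !(jmulZl, jmulZr) ou !jmulZr /idem_even.
generalize_products => /rowP h.
by apply/rowP => i; move: (h i); rewrite !mxE; lra.
Qed.

Lemma odd_odd (u v : V) : idem_odd u -> idem_odd v -> idem_even (u ** v).
Proof.
move=> ou ov; have ouv : idem_odd (u + v) by rewrite /idem_odd jmulDr ou ov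
  scalerDr.
move: (odd_sqr ou) (odd_sqr ov) (odd_sqr ouv).
rewrite /idem_even !(jmulDl, jmulDr) (jmulC _ v u).
generalize_products => /rowP h1 /rowP h2 /rowP h3.
by apply/rowP => i; move: (h1 i) (h2 i) (h3 i); rewrite !mxE; lra.
Qed.

(** The Peirce reflection: the identity on even vectors, -1 on odd ones.  The
parity rules above make it an automorphism. *)
Definition reflection (a : V) : V := a - 2 *: odd_part a.

Lemma reflectionD (a b : V) : reflection (a + b) = reflection a + reflection b.
Proof.
rewrite /reflection /odd_part !jmulDr; generalize_products.
by apply/rowP => i; rewrite !mxE; lra.
Qed.

Lemma reflectionZ (k : R) (a : V) : reflection (k *: a) = k *: reflection a.
Proof.
rewrite /reflection /odd_part !jmulZr; generalize_products.
by apply/rowP => i; rewrite !mxE; lra.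
Qed.

Lemma reflection_even (a : V) : idem_even a -> reflection a = a.
Proof. by move=> ea; rewrite /reflection /odd_part ea subrr !scaler0 subr0. Qed.

Lemma reflection_odd (a : V) : idem_odd a -> reflection a = - a.
Proof.
move=> oa; rewrite /reflection /odd_part oa jmulZr oa.
by apply/rowP => i; rewrite !mxE; lra.
Qed.

Lemma reflectionE (a b : V) : idem_even a -> idem_odd b ->
  reflection (a + b) = a - b.
Proof. by move=> ea ob; rewrite reflectionD reflection_even// reflection_odd.
Qed.

Lemma reflectionM (a b : V) : reflection (a ** b) =
  reflection a ** reflection b.
Proof.
have key a0 a1 b0 b1 : idem_even a0 -> idem_odd a1 -> idem_even b0 ->
    idem_odd b1 -> reflection ((a0 + a1) ** (b0 + b1)) =
    reflection (a0 + a1) ** reflection (b0 + b1); last first.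
  have := key _ _ _ _ (even_partP a) (odd_partP a) (even_partP b) (odd_partP b).
  by rewrite !subrK.
move=> ea oa eb ob; rewrite !reflectionE//.
rewrite !(jmulDl, jmulDr, jmulNl, jmulNr, reflectionD).
rewrite (reflection_even (even_even ea eb)) (reflection_even (odd_odd oa ob)).
rewrite (reflection_odd (even_odd ea ob)) (jmulC _ a1 b0).
rewrite (reflection_odd (even_odd eb oa)).
by apply/rowP => i; rewrite !mxE; lra.
Qed.

Lemma reflectionK : involutive reflection.
Proof.
move=> a; have [ea oa] := (even_partP a, odd_partP a).
have ona : idem_odd (- odd_part a) by rewrite /idem_odd jmulNr oa scalerN.
rewrite -{1}(subrK (odd_part a) a) (reflectionE ea oa) (reflectionE ea ona).
by rewrite opprK subrK.
Qed.

Lemma reflection1 : reflection e = e.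
Proof. by apply: reflection_even; rewrite /idem_even !jmulr1. Qed.

Lemma jeval_reflection (q : {poly R}) (x : V) :
  jeval J q (reflection x) = reflection (jeval J q x).
Proof.
elim/poly_ind: q => [|q a IH].
  by rewrite !jeval0 -(scale0r e) reflectionZ reflection1.
rewrite !jevalD !jevalM !jevalX -!alg_polyC !jevalZ !jeval1 IH.
by rewrite reflectionD reflectionM reflectionZ reflection1.
Qed.

Lemma minimal_polynomial_reflection (x : V) p :
  minimal_polynomial J x p -> minimal_polynomial J (reflection x) p.
Proof.
have r0 : reflection 0 = 0 by rewrite -(scale0r e) reflectionZ reflection1.
move=> [pm px pmin]; split=> // [|q q0].
  by rewrite jeval_reflection px.
by rewrite jeval_reflection -{1}r0 => /(inv_inj reflectionK); exact: pmin.
Qed.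

Lemma jdot_odd_part (a b : V) : dot (odd_part a) b = dot a (odd_part b).
Proof.
rewrite /odd_part jdotZl jdotZr jdotDl jdotNl jdotDr jdotNr.
by rewrite !jdot_associative.
Qed.

End idempotents.

(** * Polynomial maps and regular elements *)

Section polynomial_maps.
Variables (R : realType) (n : nat).
Local Notation V := 'rV[R]_n.

Lemma poly_eq0_horner (p : {poly R}) : (forall s, p.[s] = 0) -> p = 0.
Proof.
move=> p0; apply/eqP/negPn/negP => pn0.
have := @max_poly_roots _ p [seq i%:R | i <- iota 0 (size p)] pn0.
rewrite size_map size_iota ltnn => h; suff : false by []; apply: h.
  by apply/allP => _ /mapP[i _ ->]; rewrite /root p0.
by rewrite map_inj_uniq ?iota_uniq//; exact: mulrIn (oner_neq0 _).
Qed.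

(** The form in which density of regular elements is used: identities between
polynomials in s only have to be checked outside the zeros of some g. *)
Lemma poly_eq_generic (g p q : {poly R}) : g != 0 ->
  (forall s, g.[s] != 0 -> p.[s] = q.[s]) -> p = q.
Proof.
move=> g0 gpq; apply/eqP; rewrite -subr_eq0.
suff /eqP : g * (p - q) = 0 by rewrite mulf_eq0 (negbTE g0).
apply: poly_eq0_horner => s; rewrite hornerM hornerD hornerN.
by have [->|/gpq ->] := eqVneq g.[s] 0; rewrite ?mul0r// subrr mulr0.
Qed.

(** Polynomials on V are only used through their restrictions to lines.  The vector
w is the differential at a: the coefficients of degree 1 on all the lines through
a are given by one linear form. *)
Definition polynomial_map (f : V -> R) := forall a, exists w : V,
  forall d, exists p : {poly R},
    (forall s, f (a + s *: d) = p.[s]) /\ p`_1 = \sum_i w ord0 i * d ord0 i.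

Lemma polynomial_map_ext (f g : V -> R) : f =1 g -> polynomial_map f ->
  polynomial_map g.
Proof. by move=> /funext ->. Qed.

Lemma polynomial_map_cst (k : R) : polynomial_map (fun=> k).
Proof.
move=> a; exists 0 => d; exists k%:P; split=> [s|]; first by rewrite hornerC.
by rewrite coefC big1// => i _; rewrite mxE mul0r.
Qed.

Lemma polynomial_map_coord i : polynomial_map (fun x : V => x ord0 i).
Proof.
move=> a; exists (delta_mx ord0 i) => d.
exists ((a ord0 i)%:P + d ord0 i *: 'X); split=> [s|].
  by rewrite !mxE !hornerE mulrC.
rewrite !coefE mulr1 add0r (bigD1 i)//= mxE !eqxx mul1r big1 ?addr0// => j ji.
by rewrite mxE (negbTE ji) andbF mul0r.
Qed.

Lemma polynomial_mapD (f g : V -> R) : polynomial_map f -> polynomial_map g ->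
  polynomial_map (fun x => f x + g x).
Proof.
move=> pf pg a; have [[wf pwf] [wg pwg]] := (pf a, pg a).
exists (wf + wg) => d; have [[p [pE p1]] [q [qE q1]]] := (pwf d, pwg d).
exists (p + q); split=> [s|]; first by rewrite pE qE hornerD.
rewrite coefD p1 q1 -big_split; apply: eq_bigr => i _ /=.
by rewrite mxE mulrDl.
Qed.

Lemma polynomial_mapM (f g : V -> R) : polynomial_map f -> polynomial_map g ->
  polynomial_map (fun x => f x * g x).
Proof.
move=> pf pg a; have [[wf pwf] [wg pwg]] := (pf a, pg a).
exists (f a *: wg + g a *: wf) => d.
have [[p [pE p1]] [q [qE q1]]] := (pwf d, pwg d).
exists (p * q); split=> [s|]; first by rewrite pE qE hornerM.
have := pE 0; have := qE 0; rewrite scale0r addr0 !horner_coef0 => ga fa.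
rewrite coefM big_ord_recl big_ord1 /= p1 q1 -fa -ga mulrC [X in _ + X]mulrC
  addrC.
rewrite [RHS](_ : _ = \sum_i (f a * (wg ord0 i * d ord0 i)) +
  \sum_i (g a * (wf ord0 i * d ord0 i))).
  by rewrite -!mulr_sumr addrC mulrC.
by rewrite -big_split; apply: eq_bigr => i _ /=; rewrite !mxE mulrDl !mulrA.
Qed.

Lemma polynomial_map_sum (I : Type) (s : seq I) (P : pred I) (F : I -> V -> R) :
  (forall i, polynomial_map (F i)) ->
  polynomial_map (fun x => \sum_(i <- s | P i) F i x).
Proof.
move=> pF; elim: s => [|i s IH].
  by apply: (polynomial_map_ext (f := fun=> 0)) (polynomial_map_cst 0) => x;
    rewrite big_nil.
have [Pi|nPi] := boolP (P i).
  apply: polynomial_map_ext (polynomial_mapD (pF i) IH) => x.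
  by rewrite big_cons Pi.
by apply: polynomial_map_ext IH => x; rewrite big_cons (negbTE nPi).
Qed.

Lemma polynomial_map_prod (I : Type) (s : seq I) (P : pred I) (F : I -> V ->
  R) :
  (forall i, polynomial_map (F i)) ->
  polynomial_map (fun x => \prod_(i <- s | P i) F i x).
Proof.
move=> pF; elim: s => [|i s IH].
  by apply: (polynomial_map_ext (f := fun=> 1)) (polynomial_map_cst 1) => x;
    rewrite big_nil.
have [Pi|nPi] := boolP (P i).
  apply: polynomial_map_ext (polynomial_mapM (pF i) IH) => x.
  by rewrite big_cons Pi.
by apply: polynomial_map_ext IH => x; rewrite big_cons (negbTE nPi).
Qed.

Lemma polynomial_map_exp (f : V -> R) k : polynomial_map f ->
  polynomial_map (fun x => f x ^+ k).
Proof.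
move=> pf; elim: k => [|k IH].
  exact: polynomial_map_ext (polynomial_map_cst 1).
by apply: polynomial_map_ext (polynomial_mapM pf IH) => x; rewrite exprS.
Qed.

Lemma polynomial_map_det k (A : V -> 'M[R]_k) :
  (forall i j, polynomial_map (fun x => A x i j)) ->
  polynomial_map (fun x => \det (A x)).
Proof.
move=> pA; apply: polynomial_map_sum => s; apply: polynomial_mapM.
  exact: polynomial_map_cst.
by apply: polynomial_map_prod => i; exact: pA.
Qed.

Lemma polynomial_map_meval (P : mpoly.mpoly n R) :
  polynomial_map (fun x => mpoly.meval (fun i => x ord0 i) P).
Proof.
apply: polynomial_map_ext (fun x => esym (mpoly.mevalE _ _)) _.
apply: polynomial_map_sum => k; apply: polynomial_mapM.
  exact: polynomial_map_cst.
by apply: polynomial_map_prod => i;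
  exact/polynomial_map_exp/polynomial_map_coord.
Qed.

Lemma continuous_meval (P : mpoly.mpoly n R) :
  continuous (fun x : V => mpoly.meval (fun i => x ord0 i) P).
Proof.
have -> : (fun x : V => mpoly.meval (fun i => x ord0 i) P) =
  (fun x : V => \sum_(k <- mpoly.msupp P)
           mpoly.mcoeff k P * \prod_i x ord0 i ^+ mpoly.fun_of_multinom k i).
  by apply/funext => x; exact: mpoly.mevalE.
apply: continuous_big => [|k _]; first exact: add_continuous.
move=> x; apply: continuousM; first exact: cst_continuous.
move: x; apply: continuous_big => [|i _]; first exact: mul_continuous.
move=> x; apply: (@continuous_comp _ _ _ (fun x : V => x ord0 i)
  (fun y : R => y ^+ mpoly.fun_of_multinom k i)).
  exact: coord_continuous.
exact: exprn_continuous.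
Qed.

End polynomial_maps.

Section regular.
Variables (R : realType) (m : nat) (J : euclidean_jordan_algebra R m.+1).
Local Notation V := 'rV[R]_m.+1.
Local Notation "x ** y" := (jmul J x y) (at level 40, left associativity).
Local Notation dot := (jdot J).

Lemma polynomial_map_jmul (f g : V -> V) :
  (forall i, polynomial_map (fun x => f x ord0 i)) ->
  (forall i, polynomial_map (fun x => g x ord0 i)) ->
  forall i, polynomial_map (fun x => (f x ** g x) ord0 i).
Proof.
move=> pf pg i.
apply: (polynomial_map_ext (f := fun x =>
  \sum_j \sum_k (f x ord0 j * g x ord0 k) *
    (delta_mx ord0 j ** delta_mx ord0 k) ord0 i)).
  move=> x; rewrite {2}[f x]row_sum_delta {2}[g x]row_sum_delta jmul_suml
    summxE.
  apply: eq_bigr => j _; rewrite linear_sum summxE; apply: eq_bigr => k _ /=.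
  by rewrite jmulZl jmulZr scalerA mxE.
do 2 (apply: polynomial_map_sum => ?); apply: polynomial_mapM.
  by apply: polynomial_mapM.
exact: polynomial_map_cst.
Qed.

Lemma polynomial_map_jdot (f g : V -> V) :
  (forall i, polynomial_map (fun x => f x ord0 i)) ->
  (forall i, polynomial_map (fun x => g x ord0 i)) ->
  polynomial_map (fun x => dot (f x) (g x)).
Proof.
move=> pf pg.
apply: (polynomial_map_ext (f := fun x =>
  \sum_j \sum_k (f x ord0 j * g x ord0 k) * dot (delta_mx ord0 j)
    (delta_mx ord0 k))).
  move=> x; rewrite {2}[f x]row_sum_delta {2}[g x]row_sum_delta jdot_suml.
  apply: eq_bigr => j _; rewrite linear_sum; apply: eq_bigr => k _ /=.
  by rewrite jdotZl jdotZr mulrA.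
do 2 (apply: polynomial_map_sum => ?); apply: polynomial_mapM.
  by apply: polynomial_mapM.
exact: polynomial_map_cst.
Qed.

Definition jordan_regular r (x : V) :=
  exists p, minimal_polynomial J x p /\ size p = r.+1.

Definition power_gram r (x : V) : 'M[R]_r :=
  \matrix_(i, j) dot (jpow J x i) (jpow J x j).

Lemma polynomial_map_gram r : polynomial_map (fun x => \det (power_gram r x)).
Proof.
have pj k i : polynomial_map (fun x => jpow J x k ord0 i).
  elim: k i => [|k IH] i; first exact: polynomial_map_cst.
  by apply: polynomial_map_jmul => //; exact: polynomial_map_coord.
apply: polynomial_map_det => i j.
apply: (polynomial_map_ext (f := fun x => dot (jpow J x i) (jpow J x j))).
  by move=> x; rewrite mxE.
by apply: polynomial_map_jdot.
Qed.

Lemma mul_power_gram r (x : V) (v : 'rV[R]_r) j :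
  (v *m power_gram r x) ord0 j = dot (\sum_(i < r) v ord0 i *: jpow J x i)
    (jpow J x j).
Proof.
by rewrite mxE jdot_suml; apply: eq_bigr => i _; rewrite mxE jdotZl.
Qed.

Lemma jeval_widen (q : {poly R}) (x : V) r : (size q <= r)%N ->
  jeval J q x = \sum_(i < r) q`_i *: jpow J x i.
Proof.
move=> qr; rewrite /jeval (big_ord_widen r (fun i => q`_i *: jpow J x i))//.
rewrite big_mkcond; apply: eq_bigr => i _; case: ltnP => // qi.
by rewrite nth_default// scale0r.
Qed.

Lemma regular_gram r (x : V) : jordan_regular r x -> \det (power_gram r x) != 0.
Proof.
move=> [p [[_ _ pmin] sp]]; apply/negP => /det0P[v v0 vG].
pose q : {poly R} := rVpoly v.
have sq : (size q <= r)%N by exact: size_poly.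
have qE : jeval J q x = \sum_(i < r) v ord0 i *: jpow J x i.
  rewrite (jeval_widen _ sq); apply: eq_bigr => i _.
  by rewrite coef_rVpoly_ord.
have q0 : q != 0.
  by apply: contraNneq v0 => q0; rewrite -[v]rVpolyK -/q q0 linear0.
have /(pmin _ q0) : jeval J q x = 0.
  apply: (jdot_eq0 (J := J)); rewrite {2}qE linear_sum big1// => j _.
  by rewrite linearZ /= qE -mul_power_gram vG mxE mulr0.
by rewrite sp => /leq_trans/(_ sq); rewrite ltnn.
Qed.

Variable r : nat.
Hypothesis rankJ : jordan_rank J r.

(** The powers x^0, ..., x^(r-1) are independent exactly when their Gram
determinant does not vanish, and then the minimal polynomial has degree r. *)
Lemma gram_regular (x : V) : \det (power_gram r x) != 0 -> jordan_regular r x.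
Proof.
move=> G0; have [p pP] := minimal_polynomial_exists J x; exists p; split=> //.
apply/eqP; rewrite eqn_leq; have [_ /(_ _ _ pP) -> /=] := rankJ.
rewrite ltnNge; apply/negP => pr; move/negP: G0; apply; apply/det0P.
have [pm px _] := pP; exists (poly_rV p : 'rV[R]_r).
  apply: contraTneq (monic_neq0 pm) => p0.
  by rewrite -(poly_rV_K pr) p0 linear0 eqxx.
apply/rowP => j; rewrite mul_power_gram [RHS]mxE.
have -> : \sum_(i < r) (poly_rV p : 'rV[R]_r) ord0 i *: jpow J x i =
  jeval J p x.
  by rewrite (jeval_widen _ pr); apply: eq_bigr => i _; rewrite mxE.
by rewrite px jdotC linear0.
Qed.

(** The Gram determinant along the line is a polynomial in s, and it is nonzero at
s = 1. *)
Lemma regular_line (x0 y : V) : jordan_regular r x0 ->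
  exists2 g : {poly R}, g != 0 &
    forall s, g.[s] != 0 -> jordan_regular r (y + s *: (x0 - y)).
Proof.
move=> /regular_gram G0;
  have [w /(_ (x0 - y))[g [gE _]]] := polynomial_map_gram r y.
exists g => [|s]; last by rewrite -gE; exact: gram_regular.
by apply: contraNneq G0 => g0; have := gE 1;
  rewrite g0 horner0 scale1r subrKC => ->.
Qed.

End regular.

(** * The determinant *)

Section determinant.
Variables (R : realType) (m : nat) (J : euclidean_jordan_algebra R m.+1)
  (r : nat).
Local Notation V := 'rV[R]_m.+1.
Local Notation "x ** y" := (jmul J x y) (at level 40, left associativity).
Local Notation dot := (jdot J).
Local Notation e := (jone J).

Hypothesis rankJ : jordan_rank J r.
Variable Delta : V -> R.
Hypothesis hDelta : jordan_determinant J r Delta.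

Lemma determinant_polynomial : polynomial_map Delta.
Proof.
have [[P DP] _] := hDelta.
exact: polynomial_map_ext (fun x => esym (DP x)) (polynomial_map_meval P).
Qed.

Lemma determinant_continuous : continuous Delta.
Proof.
have [[P DP] _] := hDelta.
have -> : Delta = fun x => mpoly.meval (fun i => x ord0 i) P by apply/funext.
exact: continuous_meval.
Qed.

Lemma determinant_line (a d : V) :
  exists p : {poly R}, forall s, Delta (a + s *: d) = p.[s].
Proof.
by have [w /(_ d)[p [pE _]]] := determinant_polynomial a; exists p.
Qed.

Lemma regular_exists : exists x, jordan_regular J r x.
Proof. by have [[x [p [pP sp]]] _] := rankJ; exists x; exists p. Qed.

Lemma regular_frame (x : V) : jordan_regular J r x ->
  exists (l : 'I_r -> R) (c : 'I_r -> V),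
    [/\ injective l, jordan_frame J c & x = \sum_i l i *: c i].
Proof. by move=> [p [pP sp]]; exact: frame_of_minimal_polynomial pP sp. Qed.

(** When the l_i are distinct this is the definition of the determinant at a
regular element; the general case follows by a polynomial perturbation of the
l_i. *)
Lemma determinant_frame (c : 'I_r -> V) (l : 'I_r -> R) : jordan_frame J c ->
  Delta (\sum_i l i *: c i) = \prod_i l i.
Proof.
move=> cP; have inj_case k : injective k ->
    Delta (\sum_i k i *: c i) = \prod_i k i.
  move=> kinj; have [_ /(_ _ _ (frame_minimal_polynomial cP kinj)) ->] :=
    hDelta.
    rewrite -horner_coef0 horner_prod;
      under eq_bigr do rewrite hornerXsubC sub0r.
    by rewrite prodrN cardT size_enum_ord mulrA -expr2 sqrr_sign mul1r.
  by rewrite size_prod_XsubC /index_enum -enumT size_enum_ord.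
(* Separate the values by moving them at different speeds. *)
pose k s (i : 'I_r) : R := l i + s * i%:R.
have kE s : \sum_i k s i *: c i = \sum_i l i *: c i + s *: \sum_(i < r) i%:R *:
  c i.
  rewrite scaler_sumr -big_split; apply: eq_bigr => i _ /=.
  by rewrite scalerA -scalerDl.
have [p pE] := determinant_line (\sum_i l i *: c i) (\sum_(i < r) i%:R *: c i).
pose q : {poly R} := \prod_i ((l i)%:P + i%:R *: 'X).
pose g : {poly R} := \prod_i \prod_(j | j != i) ((l i - l j)%:P +
  (i%:R - j%:R) *: 'X).
have /poly_eq_generic : g != 0.
  apply/prodf_neq0 => i _; apply/prodf_neq0 => j ji; apply/eqP => h.
  have := congr1 (fun u : {poly R} => u`_1) h; rewrite !coefE /= mulr1 add0r.
  move/eqP; rewrite subr_eq0 eqr_nat => /eqP ij; move/negP: ji; apply.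
  by apply/eqP/val_inj.
move=> /(_ p q) pq; have {pq} : p = q.
  apply: pq => s gs; rewrite -pE -kE inj_case; last first.
    move=> i j kij; apply/eqP/negPn/negP => ij; move/negP: gs; apply.
    rewrite /g horner_prod (bigD1 i)//= horner_prod (bigD1 j) 1?eq_sym//=.
    rewrite !hornerE; have -> : l i - l j + (i%:R - j%:R) * s = k s i - k s j.
      by rewrite /k; ring.
    by rewrite kij subrr !mul0r.
  by rewrite horner_prod; apply: eq_bigr => i _; rewrite !hornerE mulrC.
move=> /(congr1 (horner^~ 0)); rewrite -pE scale0r addr0 => ->.
by rewrite horner_prod; apply: eq_bigr => i _; rewrite !hornerE ?mulr0 ?addr0.
Qed.

(** An automorphism preserves minimal polynomials, hence the determinant of
regular elements. *)
Lemma determinant_reflection (c x : V) : c ** c = c ->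
  Delta (reflection J c x) = Delta x.
Proof.
move=> cc; have [x0 /(regular_line rankJ x)[g g0 greg]] := regular_exists.
have [p pE] := determinant_line x (x0 - x).
have [q qE] := determinant_line (reflection J c x) (reflection J c (x0 - x)).
have pq : p = q.
  apply: (poly_eq_generic g0) => s /greg[f [fP sf]]; rewrite -pE -qE.
  rewrite -reflectionZ -reflectionD.
  have [_ hD] := hDelta; rewrite (hD _ _ fP sf).
  by rewrite (hD _ _ (minimal_polynomial_reflection cc fP) sf).
by have := pE 0; have := qE 0; rewrite !scale0r !addr0 pq => -> ->.
Qed.

(** The scalar product is nondegenerate, so its Gram matrix is invertible. *)
Lemma riesz (w : V) : exists v : V, forall d : V,
  \sum_i w ord0 i * d ord0 i = dot v d.
Proof.
pose G : 'M[R]_m.+1 := \matrix_(i, j) dot (delta_mx ord0 i) (delta_mx ord0 j).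
have dotG (u d : V) : dot u d = \sum_j (u *m G) ord0 j * d ord0 j.
  rewrite {1}[d]row_sum_delta linear_sum; apply: eq_bigr => j _ /=.
  rewrite jdotZr mulrC; congr (_ * _);
    rewrite {1}[u]row_sum_delta jdot_suml mxE.
  by apply: eq_bigr => i _; rewrite jdotZl mxE.
have Gu : G \in unitmx.
  rewrite unitmxE unitfE; apply/negP => /det0P[u u0 uG].
  have := jdot_gt0 J u0; rewrite dotG uG big1 ?ltxx// => j _.
  by rewrite mxE mul0r.
by exists (w *m invmx G) => d; rewrite dotG mulmxKV.
Qed.

(** The vector v represents the differential of the determinant at e, which is
the trace.  It is 1 on c_i because Delta (e + s c_i) = 1 + s, and it vanishes on
odd vectors u because a Peirce reflection exchanges e + s u and e - s u. *)
Lemma trace_form : exists v : V,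
  (forall (c : 'I_r -> V), jordan_frame J c -> forall i, dot v (c i) = 1) /\
  (forall c u, c ** c = c -> idem_odd J c u -> dot v u = 0).
Proof.
have [w wP] := determinant_polynomial e; have [v vP] := riesz w.
exists v; split=> [c cP i|c u cc ou].
  have [p [pE]] := wP (c i); rewrite vP => <-.
  suff -> : p = 1 + 'X by rewrite coefD coef1 coefX add0r.
  apply/eqP; rewrite -subr_eq0; apply/eqP/poly_eq0_horner => s.
  rewrite hornerD -pE hornerN !hornerE.
  have [_ _ ce] := cP.
  have -> : e + s *: c i = \sum_j (1 + (j == i)%:R * s) *: c j.
    rewrite -ce (bigD1 i)//= [RHS](bigD1 i)//= eqxx mul1r scalerDl scale1r
      addrAC.
    congr (_ + _); apply: eq_bigr => j /negbTE ->.
    by rewrite mul0r addr0 scale1r.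
  rewrite determinant_frame// (bigD1 i)//= eqxx mul1r big1 ?mulr1 ?subrr//.
  by move=> j /negbTE ->; rewrite mul0r addr0.
have [[p [pE p1]] [q [qE q1]]] := (wP u, wP (- u)); move: p1 q1; rewrite !vP.
have -> : q = p.
  apply/eqP; rewrite -subr_eq0; apply/eqP/poly_eq0_horner => s.
  rewrite hornerD hornerN -pE -qE -[X in X - _](determinant_reflection _ cc).
  rewrite reflectionD reflectionZ (reflection1 cc) reflection_odd.
    by rewrite opprK subrr.
  by rewrite /idem_odd jmulNr ou scalerN.
by move=> -> ; rewrite jdotNr; lra.
Qed.

Hypothesis simpleJ : simple_jordan_algebra J.

Let jcomm (v x : V) := forall y, v ** (x ** y) = x ** (v ** y).

Let jcommD (v x y : V) : jcomm v x -> jcomm v y -> jcomm v (x + y).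
Proof. by move=> vx vy z; rewrite !jmulDl jmulDr vx vy. Qed.

Let jcommZ (v x : V) (k : R) : jcomm v x -> jcomm v (k *: x).
Proof. by move=> vx z; rewrite !jmulZl jmulZr vx. Qed.

(** Elements commuting with v form a subspace, and every x is a combination of
two regular elements. *)
Let central (v : V) : (forall x, jordan_regular J r x -> jcomm v x) ->
  forall x, jcomm v x.
Proof.
move=> vreg x; have [x0 x0reg] := regular_exists.
have [g g0 greg] := regular_line rankJ x x0reg.
have [s] : exists s, (g * ('X - 1%:P)).[s] != 0.
  apply: contrapT => /forallNP h; move: g0.
  suff /eqP : g * ('X - 1%:P) = 0 by rewrite mulf_eq0 polyXsubC_eq0 orbF => ->.
  by apply: poly_eq0_horner => s; apply/eqP; have /negP := h s; rewrite negbK.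
rewrite hornerM hornerXsubC mulf_eq0 negb_or subr_eq0 => /andP[gs s1].
have xE : x = (1 - s)^-1 *: ((x + s *: (x0 - x)) + (- s) *: x0).
  have -> : x + s *: (x0 - x) + (- s) *: x0 = (1 - s) *: x.
    by apply/rowP => i; rewrite !mxE; ring.
  by rewrite scalerA mulVf ?scale1r// subr_eq0 eq_sym.
rewrite xE; apply/jcommZ/jcommD; first exact/vreg/greg.
exact/jcommZ/vreg.
Qed.

(** Multiplication by v has a real eigenvalue, a root of the minimal polynomial;
if v is central the eigenspace is an ideal, hence everything. *)
Let central_scalar (v : V) : (forall x, jcomm v x) -> exists a, v = a *: e.
Proof.
move=> vc; have [p pP] := minimal_polynomial_exists J v.
have [s [_ pE]] := minimal_polynomial_split pP.
have [pm pv pmin] := pP.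
case: s pE => [|a s] pE.
  by have := jone_neq0 J; rewrite -(jeval1 J v) -pv pE big_nil eqxx.
exists a; pose g := \prod_(b <- s) ('X - b%:P); set u := jeval J g v.
have pg : p = ('X - a%:P) * g by rewrite pE big_cons.
have u0 : u != 0.
  apply/eqP => gv; have := pmin g _ gv.
  rewrite monic_neq0 ?monic_prod_XsubC// pE !size_prod_XsubC ltnn.
  by move=> /(_ isT).
pose f : V -> V := fun x => v ** x - a *: x.
have f_lin : linear f.
  move=> k x y; rewrite /f jmulDr jmulZr; generalize_products.
  by apply/rowP => i; rewrite !mxE; ring.
pose F : {linear V -> V} := HB.pack f (GRing.isLinear.Build R V V _ f f_lin).
have inI x : (x \in lker (linfun F)) = (v ** x - a *: x == 0).
  by rewrite memv_ker lfunE.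
have [_ /(_ (lker (linfun F)))] := simpleJ; case.
- move=> x y; rewrite !inI !subr_eq0 => /eqP vx; apply/eqP.
  by rewrite vc vx jmulZr.
- move=> I0; move/negP: u0; case; rewrite -memv0 -I0 inI.
  by rewrite -{1}(jevalX J v) -jevalM -/u -jevalZ -jevalN -jevalD -mul_polyC
    -mulrBl -pg pv.
- move=> IT; have := memvf e; rewrite -IT inI subr_eq0 jmulr1 => /eqP.
  by [].
Qed.

(** The differential v of the determinant at e is orthogonal to the odd vectors of
every idempotent, so that it commutes with every frame; being central it is a
multiple a e of e, and 1 = <v, c_i> = a |c_i|^2. *)
Lemma frame_norm : exists kappa : R,
  forall c : 'I_r -> V, jordan_frame J c -> forall i, dot (c i) (c i) = kappa.
Proof.
have [v [v1 v0]] := trace_form.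
have veven c : c ** c = c -> idem_even J c v.
  move=> cc; set o := odd_part J c v.
  have oo : idem_odd J c o by exact: odd_partP.
  have oE : odd_part J c o = o.
    rewrite /odd_part oo jmulZr oo; apply/rowP => i; rewrite !mxE; lra.
  have o0 : o = 0.
    apply: (jdot_eq0 (J := J)); rewrite {1}/o jdot_odd_part oE.
    exact: v0 oo.
  by have := even_partP cc v; rewrite -/o o0 subr0.
have [a vE] : exists a, v = a *: e.
  apply/central_scalar/central => x /regular_frame[l [c [_ cP ->]]] y.
  rewrite !jmul_suml linear_sum; apply: eq_bigr => i _ /=.
  have ci := frame_idem cP i.
  rewrite !jmulZl jmulZr -(even_comm ci _ (veven _ ci)) //.
exists a^-1 => c cP i; have := v1 c cP i.
rewrite vE jdotZl -{1}(frame_idem cP i) jdotC jdot_sqr => h.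
have a0 : a != 0 by apply: contra_eqN h => /eqP ->;
  rewrite mul0r eq_sym oner_neq0.
by apply: (mulfI a0); rewrite h mulfV.
Qed.

(** Concavity of the logarithm. *)
Let ln_ratio (x y : R) : 0 < x -> 0 < y -> ln x - ln y <= x / y - 1.
Proof.
move=> x0 y0; rewrite -ln_div ?posrE//.
rewrite -{1}(subrKC 1 (x / y)); apply: le_ln1Dx.
by rewrite ltrBrDr addrC subrr divr_gt0.
Qed.

(** For t = sum_j l_j c_j and z = sum_i k_i d_i, the matrix of the scalar products
of the d_i and c_j is nonnegative with constant row and column sums, so concavity
of the logarithm gives sum_j ln l_j <= sum_i ln k_i as soon as t <= z. *)
Lemma determinant_le_regular (t z : V) :
  jordan_regular J r t -> jordan_regular J r z ->
  (forall c, c ** c = c -> c != 0 -> 0 < dot t c) ->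
  (forall c, c ** c = c -> dot t c <= dot z c) ->
  Delta t <= Delta z.
Proof.
move=> /regular_frame[l [c [_ cP tE]]] /regular_frame[k [d [_ dP zE]]] tpos tz.
have [kap kapP] := frame_norm.
have [_ c0 ce] := cP; have [_ d0 de] := dP.
have l0 j : 0 < l j.
  rewrite -(pmulr_lgt0 _ (frame_gt0 cP j)) -(frame_dot_sum cP) -tE.
  by apply: tpos => //; exact: (frame_idem cP).
have k0 i : 0 < k i.
  rewrite -(pmulr_lgt0 _ (frame_gt0 dP i)) -(frame_dot_sum dP) -zE.
  apply: lt_le_trans (tz _ (frame_idem dP i)).
  by apply: tpos => //; exact: (frame_idem dP).
rewrite tE zE !determinant_frame//.
have lnE (f : 'I_r -> R) : (forall i,
  0 < f i) -> \prod_i f i = expR (\sum_i ln (f i)).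
  by move=> f0; rewrite expR_sum; apply: eq_bigr => i _; rewrite lnK ?posrE.
rewrite !lnE// ler_expR.
have [i0|r0] := pselect (exists i : 'I_r, True); last first.
  by rewrite !big1// => i _; case: r0; exists i.
have kap0 : 0 < kap by case: i0 => i _; rewrite -(kapP c cP i);
  exact: frame_gt0.
rewrite -(ler_pM2l kap0) -subr_le0.
have colsum j : \sum_i dot (d i) (c j) = kap.
  by rewrite -jdot_suml de jdotC -{1}(frame_idem cP j) jdot_sqr kapP.
have rowsum i : \sum_j dot (d i) (c j) = kap.
  by rewrite -linear_sum /= ce -{1}(frame_idem dP i) jdot_sqr kapP.
have -> : kap * (\sum_j ln (l j)) - kap * (\sum_i ln (k i)) =
    \sum_i \sum_j dot (d i) (c j) * (ln (l j) - ln (k i)).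
  transitivity (\sum_i \sum_j dot (d i) (c j) * ln (l j) -
     \sum_i \sum_j dot (d i) (c j) * ln (k i)).
    congr (_ - _).
      rewrite exchange_big mulr_sumr; apply: eq_bigr => j _ /=.
      by rewrite -mulr_suml colsum.
    rewrite mulr_sumr; apply: eq_bigr => i _ /=.
    by rewrite -mulr_suml rowsum.
  rewrite -sumrB; apply: eq_bigr => i _; rewrite -sumrB.
  by apply: eq_bigr => j _; rewrite mulrBr.
apply: sumr_le0 => i _.
have K0 j : 0 <= dot (d i) (c j).
  by rewrite -(frame_idem dP i); apply: idem_dot_sqr_ge0; exact: frame_idem.
apply: (@le_trans _ _ (\sum_j dot (d i) (c j) * (l j / k i - 1))).
  by apply: ler_sum => j _; rewrite ler_wpM2l// ln_ratio.
have -> : \sum_j dot (d i) (c j) * (l j / k i - 1) =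
    dot t (d i) / k i - kap.
  rewrite -(rowsum i) tE jdot_suml mulr_suml -sumrB; apply: eq_bigr => j _.
  by rewrite jdotZl (jdotC _ (c j)); ring.
rewrite subr_le0 ler_pdivrMr// (le_trans (tz _ (frame_idem dP i)))//.
by rewrite zE (frame_dot_sum dP) (kapP d dP) mulrC.
Qed.

End determinant.

(** * Monotonicity of the determinant on the cone *)

Section poly_limit.
Variable R : realType.

Lemma poly_nonroot (g : {poly R}) (eps : R) : g != 0 -> 0 < eps ->
  exists s, [/\ 0 < s, s < eps & g.[s] != 0].
Proof.
move=> g0 e0; apply: contrapT => /forallNP h.
have := @max_poly_roots _ g [seq eps / k.+2%:R | k <- iota 0 (size g)] g0.
rewrite size_map size_iota ltnn => rts; suff : false by []; apply: rts.
  apply/allP => _ /mapP[k _ ->]; apply/negPn/negP => gk;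
    apply: (h (eps / k.+2%:R)).
  by rewrite divr_gt0// ltr_pdivrMr// ltr_pMr// ltr1n.
rewrite map_inj_uniq ?iota_uniq// => i j /(mulfI (lt0r_neq0 e0))/invr_inj/eqP.
by rewrite eqr_nat => /eqP[].
Qed.

Lemma poly_ge0_at0 (f g : {poly R}) (eps : R) : g != 0 -> 0 < eps ->
  (forall s, 0 < s -> s < eps -> g.[s] != 0 -> 0 <= f.[s]) -> 0 <= f.[0].
Proof.
move=> g0 e0 fge; rewrite leNgt; apply/negP => f0.
have : \forall s \near (0 : R), f.[s] < 0.
  have := @continuous_horner R f 0 => /(_ [set y | y < 0]); apply.
  exact: open_nbhs_nbhs (conj (@open_lt R 0) f0).
move=> /nbhs_ballP[del /= del0 fneg].
have me0 : 0 < Num.min del eps by rewrite lt_min del0.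
have [s [s0 sm gs]] := poly_nonroot g0 me0.
have : f.[s] < 0.
  apply: fneg; rewrite /ball /= sub0r normrN gtr0_norm//.
  by rewrite (lt_le_trans sm)// ge_min lexx.
rewrite ltNge fge// (lt_le_trans sm)// ge_min lexx orbT//.
Qed.

End poly_limit.

Section cone.
Variables (R : realType) (m : nat) (J : euclidean_jordan_algebra R m.+1)
  (r : nat).
Local Notation V := 'rV[R]_m.+1.
Local Notation "x ** y" := (jmul J x y) (at level 40, left associativity).
Local Notation dot := (jdot J).
Local Notation e := (jone J).

Lemma jdot_cauchy_schwarz (x y : V) : dot x y ^+ 2 <= dot x x * dot y y.
Proof.
have [->|y0] := eqVneq y 0; first by rewrite !jdot0r expr0n mulr0.
have yy := jdot_gt0 J y0.
have := jdot_ge0 J (dot y y *: x - dot x y *: y).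
rewrite !(jdotDl, jdotDr, jdotNl, jdotNr, jdotZl, jdotZr) (jdotC _ y x) => h.
rewrite -(ler_pM2l yy) -subr_ge0; apply: le_trans h _.
by rewrite le_eqVlt; apply/orP; left; apply/eqP; ring.
Qed.

(** Coordinates are scalar products with fixed vectors. *)
Lemma coord_sqr_le : exists2 B : R, 0 <= B &
  forall (x : V) i, x ord0 i ^+ 2 <= B * dot x x.
Proof.
have vP i : exists v : V, forall d : V, d ord0 i = dot v d.
  have [v vP] := riesz J (delta_mx ord0 i); exists v => d; rewrite -vP.
  rewrite (bigD1 i)//= mxE !eqxx mul1r big1 ?addr0// => j ji.
  by rewrite mxE (negbTE ji) andbF mul0r.
have /choice[v {}vP] := vP.
exists (\sum_i dot (v i) (v i)); first by apply: sumr_ge0 => i _;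
  exact: jdot_ge0.
move=> x i; rewrite (vP i x); apply: le_trans (jdot_cauchy_schwarz _ _) _.
rewrite ler_wpM2r ?jdot_ge0// (bigD1 i)//= lerDl.
by apply: sumr_ge0 => j _; exact: jdot_ge0.
Qed.

(** Since <a^2, e> = <a, a>, the linear form <., e> controls the norm on squares. *)
Lemma sqr_coord_le : exists2 C : R, 0 < C &
  forall (a : V) i, `|(a ** a) ord0 i| <= C * dot (a ** a) e.
Proof.
have [B B0 BP] := coord_sqr_le.
pose K := \sum_i \sum_j \sum_k `|(delta_mx ord0 j ** delta_mx ord0 k : V) ord0
  i|.
have K0 : 0 <= K by do 3 (apply: sumr_ge0 => ? _); exact: normr_ge0.
exists (K * B + 1) => [|a i]; first by rewrite ltr_wpDl// mulr_ge0.
rewrite jdot_sqr.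
apply: (@le_trans _ _ (\sum_j \sum_k
    `|(delta_mx ord0 j ** delta_mx ord0 k : V) ord0 i| * (B * dot a a))).
  rewrite {1 2}[a]row_sum_delta jmul_suml summxE.
  apply: le_trans (ler_norm_sum _ _ _) _; apply: ler_sum => j _.
  rewrite linear_sum summxE.
  apply: le_trans (ler_norm_sum _ _ _) _; apply: ler_sum => k _ /=.
  rewrite jmulZl jmulZr scalerA mxE normrM mulrC ler_wpM2l//.
  have := BP a j; have := BP a k;
    rewrite normrM -(real_normK (num_real (a ord0 j)))
    -(real_normK (num_real (a ord0 k))).
  move: (normr_ge0 (a ord0 j)) (normr_ge0 (a ord0 k)); nra.
rewrite mulrDl mul1r -mulrA.
under eq_bigr do rewrite -mulr_suml.
rewrite -mulr_suml ler_wpDr ?jdot_ge0//.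
apply: ler_wpM2r; first by rewrite mulr_ge0 ?jdot_ge0.
rewrite /K [leRHS](bigD1 i)//= lerDl.
by do 3 (apply: sumr_ge0 => ? _); exact: normr_ge0.
Qed.

Variable Omega : set V.
Hypothesis hOmega : irreducible_symmetric_cone J Omega.

Lemma cone_open : open Omega.
Proof. exact: irreducible_symmetric_cone_open hOmega. Qed.

Lemma cone_sqr (y : V) : Omega y -> exists a, y = a ** a.
Proof.
have [_ _ OE] := hOmega; rewrite OE => /interior_subset[a _ <-].
by exists a.
Qed.

Lemma coneD (x y : V) : Omega x -> Omega y -> Omega (x + y).
Proof.
have [[_ _ cvx _ _] _ _] := hOmega => Ox Oy.
by have := cvx _ _ 1 1 Ox Oy ltr01 ltr01; rewrite !scale1r.
Qed.

Lemma coneZ (k : R) (x : V) : 0 < k -> Omega x -> Omega (k *: x).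
Proof.
have [[_ _ cvx _ _] _ _] := hOmega => k0 Ox.
have := cvx _ _ (k / 2) (k / 2) Ox Ox; rewrite divr_gt0// => /(_ isT isT).
by rewrite -scalerDl -splitr.
Qed.

Lemma cone_coord_le : exists2 C : R, 0 < C &
  forall (y : V) i, Omega y -> `|y ord0 i| <= C * dot y e.
Proof.
have [C C0 CP] := sqr_coord_le; exists C => // y i /cone_sqr[a ->]; exact: CP.
Qed.

Lemma continuous_jdot (u : V) : continuous (fun y : V => dot y u).
Proof.
have -> : (fun y : V => dot y u) =
    (fun y : V => \sum_i y ord0 i * dot (delta_mx ord0 i) u).
  apply/funext => y; rewrite {1}[y]row_sum_delta jdot_suml.
  by apply: eq_bigr => i _; rewrite jdotZl.
apply: continuous_big => [|i _]; first exact: add_continuous.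
move=> x; apply: (@continuousM R V (fun y => y ord0 i)).
  exact: coord_continuous.
exact: cst_continuous.
Qed.

(** By self-duality it suffices that <., e> is positive on the closure of the cone
minus 0, and the bound of the coordinates by <., e> passes to the closure. *)
Lemma cone_one : Omega e.
Proof.
have [[_ _ _ dual _] _ _] := hOmega; rewrite -dual; split; first exact: memvf.
have [C C0 CP] := cone_coord_le.
move=> x clx x0.
have xC i : `|x ord0 i| <= C * dot x e.
  rewrite -subr_ge0.
  have /closure_id cl : closed [set y : V | 0 <= C * dot y e - `|y ord0 i|].
    apply: closed_comp (@closed_ge _ 0) => y _.
    apply: (@continuousB _ _ _ (fun z => C * dot z e) (fun z => `|z ord0 i|)).
      apply: continuousM; first exact: cst_continuous.
      exact: continuous_jdot.
    apply: (@continuous_comp _ _ _ (fun y : V => y ord0 i));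
      first exact: coord_continuous.
    exact: norm_continuous.
  suff : [set y : V | 0 <= C * dot y e - `|y ord0 i|] x by [].
  rewrite cl; apply: closureS clx => y Oy /=.
  by rewrite subr_ge0 CP.
rewrite lt_neqAle; apply/andP; split; last first.
  by rewrite -(pmulr_rge0 _ C0) (le_trans _ (xC ord0)).
apply: contra x0 => /eqP xe; apply/eqP/rowP => i; rewrite mxE.
by apply/eqP; have := xC i; rewrite -xe mulr0 normr_le0.
Qed.

(** The neighbourhood of e contained in the cone scales with s. *)
Lemma cone_near_one : exists2 del : R, 0 < del &
  forall (s : R) (y : V), 0 < s -> (forall i,
    `|y ord0 i| < del * s) -> Omega (s *: e + y).
Proof.
have /nbhs_ballP[del /= del0 eO] : nbhs e Omega.
  exact: open_nbhs_nbhs (conj cone_open cone_one).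
exists del => // s y s0 ys.
have -> : s *: e + y = s *: (e + s^-1 *: y).
  by rewrite scalerDr scalerA divff ?scale1r// gt_eqF.
apply: coneZ => //; apply: eO; split=> // i j; rewrite ord1 !mxE /ball /=.
rewrite opprD addNKr normrN normrM gtr0_norm ?invr_gt0//.
by rewrite mulrC ltr_pdivrMr.
Qed.

Lemma cone_line (t d : V) : Omega t ->
  exists2 del : R, 0 < del & forall s, `|s| < del -> Omega (t + s *: d).
Proof.
move=> Ot; have : \forall s \near (0 : R), Omega (t + s *: d).
  have : {for 0, continuous (fun s : R => t + s *: d)}.
    apply: continuousD; first exact: cst_continuous.
    exact: scalel_continuous.
  move=> /(_ Omega); apply; rewrite scale0r addr0.
  exact: open_nbhs_nbhs (conj cone_open Ot).
move=> /nbhs_ballP[del /= del0 dO]; exists del => // s sdel; apply: dO.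
by rewrite /ball /= sub0r normrN.
Qed.

Lemma cone_sub_one (t : V) : Omega t -> exists2 eps,
  0 < eps & Omega (t - eps *: e).
Proof.
move=> /(cone_line (- e))[del del0 dO];
  have d2 : 0 < del / 2 by rewrite divr_gt0.
exists (del / 2) => //; rewrite -scalerN; apply: dO.
by rewrite gtr0_norm// ltr_pdivrMr// ltr_pMr// ltr1n.
Qed.

(** A small multiple of e can be subtracted from t within the cone, so <t, c> is
at least a positive multiple of <e, c>. *)
Lemma cone_dot_idem (t c : V) : Omega t -> c ** c = c -> c != 0 -> 0 < dot t c.
Proof.
move=> /cone_sub_one[eps eps0 /cone_sqr[a aE]] cc c0.
have := idem_dot_sqr_ge0 cc a; rewrite -aE jdotDl jdotNl jdotZl subr_ge0.
apply: lt_le_trans; rewrite jdotC -{1}cc jdot_sqr.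
by rewrite mulr_gt0 ?jdot_gt0.
Qed.

Hypothesis simpleJ : simple_jordan_algebra J.
Hypothesis rankJ : jordan_rank J r.
Variable Delta : V -> R.
Hypothesis hDelta : jordan_determinant J r Delta.

(** Both t and t + a^2 are moved towards a regular element x0.  For all but
finitely many small s the moved points are regular, and they differ by the
square (1 - s) a^2; the inequality passes to the limit s = 0. *)
Lemma determinant_le (t y : V) : Omega t -> Omega y -> Delta t <= Delta (t + y).
Proof.
move=> Ot /cone_sqr[a ->].
have [x0 x0reg] := regular_exists rankJ.
have [g1 g10 reg1] := regular_line rankJ t x0reg.
have [g2 g20 reg2] := regular_line rankJ (t + a ** a) x0reg.
have [p pE] := determinant_line hDelta t (x0 - t).
have [q qE] := determinant_line hDelta (t + a ** a) (x0 - (t + a ** a)).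
have [del del0 dO] := cone_line (x0 - t) Ot.
suff : 0 <= (q - p).[0].
  by rewrite hornerD hornerN -pE -qE !scale0r !addr0 subr_ge0.
have g0 : g1 * g2 != 0 by rewrite mulf_neq0.
have eps0 : 0 < Num.min del 1 by rewrite lt_min del0 ltr01.
apply: (poly_ge0_at0 g0 eps0) => s s0; rewrite lt_min => /andP[sdel s1].
rewrite hornerM mulf_eq0 negb_or => /andP[/reg1 ts /reg2 zs].
rewrite hornerD hornerN -pE -qE subr_ge0.
have Ots : Omega (t + s *: (x0 - t)).
  by apply: dO; rewrite gtr0_norm.
apply: (determinant_le_regular rankJ hDelta simpleJ ts zs) => c cc.
  exact: cone_dot_idem.
rewrite -subr_ge0 -jdotNl -jdotDl.
have -> : t + a ** a + s *: (x0 - (t + a ** a)) - (t + s *: (x0 - t)) =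
    (1 - s) *: (a ** a).
  by generalize_products; apply/rowP => i; rewrite !mxE; ring.
by rewrite jdotZl mulr_ge0 ?subr_ge0 ?(ltW s1)// idem_dot_sqr_ge0.
Qed.

Lemma determinant_scale_one (s : R) : Delta (s *: e) = s ^+ r.
Proof.
have [x /regular_frame[l [c [_ cP _]]]] := regular_exists rankJ.
have [_ _ <-] := cP; rewrite scaler_sumr (determinant_frame hDelta _ cP).
by rewrite prodr_const card_ord.
Qed.

Lemma determinant_gt0 (t : V) : Omega t -> 0 < Delta t.
Proof.
move=> /cone_sub_one[eps eps0 Ote]; rewrite -(subrKC (eps *: e) t).
apply: lt_le_trans (determinant_le (coneZ eps0 cone_one) Ote).
by rewrite determinant_scale_one exprn_gt0.
Qed.

Lemma jordan_rank_bounds : (0 < r <= m.+1)%N.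
Proof.
have [x [p [pP sp]]] := regular_exists rankJ.
have := size_minimal_polynomial pP; rewrite sp ltnS => ->; rewrite andbT.
rewrite lt0n; apply/eqP => r0; have [pm px _] := pP.
have /size_poly1P[k k0 pk] : size p == 1%N by rewrite sp r0.
move: pm px; rewrite pk monicE lead_coefC => /eqP ->.
by rewrite jeval1; apply/eqP/jone_neq0.
Qed.

End cone.

(** * Measures with density, product integrals *)

Section density.
Context d (T : measurableType d) (R : realType).
Variables (mu nu : {measure set T -> \bar R}) (h : T -> R).
Hypothesis h0 : forall x, 0 <= h x.
Hypothesis mh : measurable_fun setT h.
Hypothesis nuE : forall A,
  measurable A -> nu A = (\int[mu]_(x in A) (h x)%:E)%E.
Local Open Scope ereal_scope.

Import HBNNSimple.

(** Monotone approximation by simple functions reduces this to indicators. *)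
Lemma integral_density (f : T -> \bar R) : (forall x, 0 <= f x) ->
  measurable_fun setT f -> \int[nu]_x f x = \int[mu]_x (f x * (h x)%:E).
Proof.
move=> f0 mf; pose g := nnsfun_approx measurableT mf.
have mhE : measurable_fun setT (fun x => (h x)%:E) by exact/measurable_EFinP.
have gf x : (g n x)%:E @[n --> \oo] --> f x by exact: cvg_nnsfun_approx.
have -> : \int[nu]_x f x = limn (fun n => \int[nu]_x (g n x)%:E).
  rewrite -monotone_convergence//.
  - by apply: eq_integral => x _; apply/esym/cvg_lim.
  - by move=> n; exact/measurable_EFinP.
  - by move=> n x _; rewrite lee_fin.
  - by move=> x _ a b ab; rewrite lee_fin; exact/lefP/nd_nnsfun_approx.
have -> : \int[mu]_x (f x * (h x)%:E) = limn (fun n => \int[mu]_x ((g n x)%:E *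
  (h x)%:E)).
  rewrite -monotone_convergence//.
  - apply: eq_integral => x _; apply/esym/cvg_lim => //.
    by apply: cvgeZr.
  - by move=> n; apply: emeasurable_funM => //; exact/measurable_EFinP.
  - by move=> n x _; rewrite mule_ge0 ?lee_fin.
  - move=> x _ a b ab; rewrite lee_wpmul2r ?lee_fin//.
    exact/lefP/nd_nnsfun_approx.
congr (limn _); apply/funext => n.
under eq_integral do rewrite fimfunE -fsumEFin//.
rewrite ge0_integral_fsum//; last 2 first.
  - by move=> r; exact/measurable_EFinP/measurableT_comp.
  - by move=> r x _; exact: nnfun_muleindic_ge0.
transitivity (\int[mu]_x (\sum_(y \in range (g n))
    (y * \1_(g n @^-1` [set y]) x)%:E * (h x)%:E)); last first.
  apply: eq_integral => x _; rewrite -ge0_mule_fsuml => [|y]; last first.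
    exact: nnfun_muleindic_ge0.
  by rewrite fsumEFin // -(fimfunE _ x).
rewrite ge0_integral_fsum//; last 2 first.
  - move=> y; apply: emeasurable_funM => //.
    by exact/measurable_EFinP/measurableT_comp.
  - by move=> y x _; rewrite mule_ge0 ?lee_fin//; exact: nnfun_muleindic_ge0.
apply: eq_fsbigr => r /set_mem [x _ grx].
have r0 : (0 <= r)%R by rewrite -grx.
have mr : measurable (g n @^-1` [set r]) by exact: measurable_sfunP.
rewrite integralZl_indic_nnsfun// integral_indic// setIT nuE//.
under [RHS]eq_integral do rewrite EFinM -muleA.
rewrite ge0_integralZl ?lee_fin//.
- congr (_ * _); rewrite integral_mkcond; apply: eq_integral => y _.
  by rewrite epatch_indic muleC.
- by apply: emeasurable_funM => //; exact/measurable_EFinP.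
- by move=> y _; rewrite mule_ge0 ?lee_fin.
Qed.

End density.

Section open_measurable_prod.
Variables (R : realType) (n : nat).
Local Notation V := 'rV[R]_n.

(** A pair of vectors of length n is a vector of length n + n, so that
[open_measurable_rV] applies. *)
Lemma open_measurable_prod (O : set (V * V)) : open O -> measurable O.
Proof.
move=> oO; pose f (z : V * V) : 'rV[R]_(n + n) := row_mx z.1 z.2.
pose g (x : 'rV[R]_(n + n)) : V * V := (lsubmx x, rsubmx x).
have -> : O = f @^-1` (g @^-1` O).
  by apply/seteqP; split=> -[x y] /=; rewrite /g row_mxKl row_mxKr.
have mf : measurable_fun setT f.
  apply: measurable_fun_rV => i; case: (split_ordP i) => j ->.
    rewrite (_ : _ \o _ = rV_coord j \o fst).
      by apply: measurableT_comp => //; exact: measurable_rV_coord.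
    by apply/funext => z; rewrite /rV_coord/= row_mxEl.
  rewrite (_ : _ \o _ = rV_coord j \o snd).
    by apply: measurableT_comp => //; exact: measurable_rV_coord.
  by apply/funext => z; rewrite /rV_coord/= row_mxEr.
have mgO : measurable (g @^-1` O).
  apply: open_measurable_rV; apply: open_comp => // x _.
  by apply: (@cvg_pair _ _ _ (nbhs x) (nbhs (lsubmx x)) (nbhs (rsubmx x)) _ _ _
    lsubmx rsubmx); [exact: continuous_lsubmx|exact: continuous_rsubmx].
by have := mf measurableT _ mgO; rewrite setTI.
Qed.

Lemma continuous_measurable_prod (D : set (V * V)) (f : V * V -> R) : open D ->
  (forall z, D z -> {for z, continuous f}) -> measurable_fun D f.
Proof.
move=> oD cf; apply: (measurability _ (RGenOpens.measurableE R)).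
move=> _ [_ [a [b ->] <-]]; apply: open_measurable_prod.
rewrite openE => z [Dz fz]; apply: filterI; first exact: open_nbhs_nbhs.
by apply: cf => //; apply: open_nbhs_nbhs; split.
Qed.

Lemma continuous_measurable_rV (f : V -> R) : continuous f ->
  measurable_fun setT f.
Proof.
move=> cf; apply: (measurability _ (RGenOpens.measurableE R)).
move=> _ [_ [a [b ->] <-]]; rewrite setTI; apply: open_measurable_rV.
by apply: open_comp => // x _; exact: cf.
Qed.

End open_measurable_prod.

Section product_integral.
Variable R : realType.
Local Open Scope ereal_scope.

Lemma measurable_prod_coord n (f : R -> R) : measurable_fun setT f ->
  measurable_fun setT (fun x : 'rV[R]_n => \prod_i f (x ord0 i))%R.
Proof.
move=> mf; apply: (@measurable_prod _ _ _ setT _ _ (fun i (x : 'rV[R]_n) => f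
  (x ord0 i))).
by move=> i _; apply: (measurableT_comp mf);
  exact: (@measurable_rV_coord _ R n i).
Qed.

Lemma integral_lebesgue_rVS n (f : 'rV[R]_n.+1 -> \bar R) :
  measurable_fun setT f -> (forall x, 0 <= f x) ->
  \int[lebesgue_rV]_x f x =
  \int[lebesgue_measure]_u \int[lebesgue_rV]_v f (rV_cons (u, v)).
Proof.
move=> mf f0.
pose nu : {measure set (measurableTypeR R * 'rV[R]_n)%type -> \bar R} :=
  (@lebesgue_measure R \x lebesgue_rV).
have fnn : {in setT, forall y, 0 <= f y} by [].
have mcons : measurable_fun [set: measurableTypeR R * 'rV[R]_n] (@rV_cons R n).
  exact: measurable_rV_cons.
have h := ge0_integral_pushforward mcons nu measurableT mf fnn.
transitivity (\int[pushforward nu (@rV_cons R n)]_x f x).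
  exact: eq_measure_integral.
rewrite h preimage_setT fubini_tonelli1//; last by move=> u; exact: f0.
exact: (measurableT_comp mf).
Qed.

(** Lebesgue measure on vectors being a product measure, Tonelli applies. *)
Lemma integral_prod_coord n (f : R -> R) : measurable_fun setT f ->
  (forall x, 0 <= f x)%R ->
  \int[@lebesgue_rV R n]_x (\prod_i f (x ord0 i))%:E =
  (\int[lebesgue_measure]_x (f x)%:E) ^+ n.
Proof.
move=> mf f0; elim: n => [|n IH].
  under eq_integral do rewrite big_ord0.
  by rewrite integral_dirac//= diracT mul1e.
have mP k := measurable_prod_coord (n := k) mf.
have P0 k (x : 'rV[R]_k) : (0 <= \prod_i f (x ord0 i))%R by exact: prodr_ge0.
rewrite integral_lebesgue_rVS; last 2 first.
- by apply/measurable_EFinP; exact: mP.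
- by move=> x; rewrite lee_fin.
under eq_integral => u _.
  under eq_integral => v _.
    rewrite big_ord_recl rV_cons0.
    under eq_bigr do rewrite rV_consS.
    rewrite EFinM; over.
  rewrite /= ge0_integralZl ?lee_fin//; last 2 first.
  - by apply/measurable_EFinP; exact: mP.
  - by move=> x _; rewrite lee_fin; exact: prodr_ge0.
  rewrite IH; over.
rewrite ge0_integralZr//; last 3 first.
- exact/measurable_EFinP.
- by move=> x _; rewrite lee_fin.
- by apply: expe_ge0; apply: integral_ge0 => x _; rewrite lee_fin.
by rewrite expeS.
Qed.

End product_integral.

Section cauchy_kernel.
Variables (R : realType) (s : R).
Hypothesis s0 : 0 < s.

Let k (x : R) : R := (s ^+ 2 + x ^+ 2)^-1.

Lemma cauchy_kernel_gt0 x : 0 < k x.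
Proof. by rewrite invr_gt0 ltr_wpDr ?sqr_ge0// exprn_gt0. Qed.

Lemma continuous_cauchy_kernel : continuous k.
Proof.
move=> x; apply: cvgV; first by rewrite gt_eqF// ltr_wpDr ?sqr_ge0// exprn_gt0.
by apply: cvgD; [exact: cvg_cst|exact: exprn_continuous].
Qed.

Lemma integral_cauchy_kernel :
  (\int[lebesgue_measure]_x (k x)%:E = (pi / s)%:E)%E.
Proof.
pose F x := s^-1 * atan (x / s).
have dF (x : R) : is_derive x (1 : R) F (k x).
  have -> : F = s^-1 \*: (atan \o (s^-1 \*: (@id R))).
    by apply/funext => y; congr (_ * atan _); exact: mulrC.
  apply: is_derive_eq.
  rewrite -[LHS]/(s^-1 * ((1 + (s^-1 * x) ^+ 2)^-1 * (s^-1 * 1))) /k.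
  have sx0 : s ^+ 2 + x ^+ 2 != 0 by rewrite gt_eqF// ltr_wpDr
    ?sqr_ge0// exprn_gt0.
  by field; rewrite sx0 gt_eqF.
have mk : measurable_fun setT k by exact: continuous_measurable_fun
  continuous_cauchy_kernel.
have half : (\int[lebesgue_measure]_(x in `[0%R,
  +oo[) (k x)%:E = (pi / 2 / s)%:E)%E.
  rewrite (@ge0_continuous_FTC2y _ k F 0 (s^-1 * (pi / 2))).
  - by rewrite /F mul0r atan0 mulr0 sube0 mulrC.
  - by move=> x _; rewrite ltW// cauchy_kernel_gt0.
  - by apply: continuous_subspaceT; exact: continuous_cauchy_kernel.
  - apply: cvgM; first exact: cvg_cst.
    apply: (@cvg_comp _ _ _ (fun x => x / s) atan _ +oo); last exact: cvgy_atan.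
    by apply: gt0_cvgMly; rewrite ?invr_gt0//; exact: cvg_id.
  - by move=> x _; apply: ex_derive.
  - apply: cvg_at_right_filter; apply: differentiable_continuous.
    by apply/derivable1_diffP; apply: ex_derive.
  - by move=> x _; rewrite derive1E derive_val.
have mkE D : measurable D -> measurable_fun D (EFin \o k).
  by move=> mD; apply/measurable_EFinP; exact: measurable_funS mk.
have k0 x : (0 <= (k x)%:E)%E by rewrite lee_fin ltW// cauchy_kernel_gt0.
have -> : [set: R] = `]-oo, 0%R] `|` `]0%R, +oo[.
  apply/seteqP; split=> x //= _; rewrite !in_itv /= andbT.
  by have [x0|x0] := leP x 0; [left|right].
rewrite ge0_integral_setU//=; last 2 first.
- by apply: mkE; exact: measurableU.
- apply/disj_set2P; apply/seteqP; split=> x //= []; rewrite !in_itv /= andbT.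
  by move=> /le_lt_trans /[apply]; rewrite ltxx.
rewrite (@integral_itv_obnd_cbnd _ 0 +oo%O (EFin \o k)); last exact: mkE.
rewrite half.
have kN x : k (- x) = k x by rewrite /k sqrrN.
under eq_integral do rewrite -kN.
rewrite -(ge0_integration_by_substitution0 (f := EFin \o k))//; last exact: mkE.
by rewrite [X in (X + _)%E]half -EFinD; congr (_%:E); field; rewrite gt_eqF.
Qed.

End cauchy_kernel.

Section exhaustion.
Variables (R : realType) (n : nat).
Local Notation V := 'rV[R]_n.
Local Open Scope ereal_scope.

Definition cube (s : R) : set V := [set y | forall i, (`|y ord0 i| < s)%R].

Lemma cube_open s : open (cube s).
Proof.
rewrite openE => y cy.
apply: (@filter_forall V _ (fun i => [set z : V | (`|z ord0 i| < s)%R])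
  (nbhs y)) => i.
apply: open_nbhs_nbhs; split; last exact: cy.
apply: (open_comp (f := fun z : V => `|z ord0 i|%R)) (@open_lt R s) => z _.
apply: (@continuous_comp _ _ _ (fun y : V => y ord0 i));
  first exact: coord_continuous.
exact: norm_continuous.
Qed.

Lemma measurable_cube s : measurable (cube s).
Proof. by apply: open_measurable_rV; exact: cube_open. Qed.

Lemma integral_le_exhaustion (D : set V) (f : V -> \bar R) (K : \bar R) :
  measurable D -> measurable_fun D f -> (forall y, D y -> 0 <= f y) ->
  (forall s : R, (0 < s)%R -> \int[lebesgue_rV]_(y in D `&` cube s) f y <= K) ->
  \int[lebesgue_rV]_(y in D) f y <= K.
Proof.
move=> mD mf f0 fK.
have -> : D = \bigcup_k (D `&` cube k.+1%:R).
  apply/seteqP; split=> [y Dy|y [k _ []]//].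
  pose b := (\sum_i `|y ord0 i|)%R.
  exists (Num.truncn b) => //; split=> // i.
  apply: le_lt_trans (truncnS_gt b); rewrite /b (bigD1 i)//= lerDl.
  exact: sumr_ge0.
have mDc k : measurable (D `&` cube k.+1%:R).
  by apply: measurableI => //; exact: measurable_cube.
have cv := @ge0_nondecreasing_set_cvg_integral _ V R
  (fun k => D `&` cube k.+1%:R)
  f lebesgue_rV.
have {}cv := cv _ mDc (fun k => measurable_funS mD (@subIsetl _ _ _) mf)
  (fun k y Dy => f0 y Dy.1).
have {}cv := cv _.
apply: (cvge_to_le (cv _)); last first.
  by apply: nearW => k; apply: fK.
move=> k l kl; apply/subsetPset => y [Dy cy]; split=> // i.
by apply: lt_le_trans (cy i) _; rewrite ler_nat.
Qed.

End exhaustion.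

(** * The Hardy space and measures on the tube *)

Section complex_coordinates.
Variables (R : realType) (n : nat).
Local Notation V := 'rV[R]_n.
Local Notation C := (R[i] : numFieldType).

Lemma sqr_absE (a b : R) : sqr_abs (a +i* b)%C = a ^+ 2 + b ^+ 2.
Proof. by rewrite /sqr_abs /= sqr_sqrtr// addr_ge0// sqr_ge0. Qed.

Lemma sqr_abs_ge0 (w : R[i]) : 0 <= sqr_abs w.
Proof. exact: sqr_ge0. Qed.

Lemma sqr_absM (v w : R[i]) : sqr_abs (v * w) = sqr_abs v * sqr_abs w.
Proof. by rewrite /sqr_abs Normc.normcM exprMn. Qed.

Lemma sqr_absV (w : R[i]) : sqr_abs w^-1 = (sqr_abs w)^-1.
Proof. by rewrite /sqr_abs Normc.normcV exprVn. Qed.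

Lemma norm_complexE (w : R[i]) : `|w| = ((Normc.normc w)%:C)%C.
Proof. by []. Qed.

Lemma continuous_normc : continuous (fun w : C => Normc.normc w : R).
Proof.
move=> w A /nbhs_ballP[eps /= eps0 eA]; apply/nbhs_ballP.
exists (eps%:C)%C; first by rewrite /= ltcR.
move=> v; rewrite /ball /= norm_complexE ltcR => wv; apply: eA.
rewrite /ball /= ltr_norml; apply/andP; split.
  rewrite ltrNl opprB ltrBlDr;
    apply: le_lt_trans (_ : _ <= Normc.normc (w - v) + Normc.normc w) _.
    by rewrite -(normcN (w - v)) opprB -{1}(subrK w v) le_normcD.
  by rewrite ltrD2r.
rewrite ltrBlDr; apply: le_lt_trans (_ : _ <= Normc.normc
  (w - v) + Normc.normc v) _.
  by rewrite -{1}(subrK v w) le_normcD.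
by rewrite ltrD2r.
Qed.

Lemma continuous_sqr_abs : continuous (fun w : C => sqr_abs w : R).
Proof.
move=> w; apply: (@continuous_comp _ _ _ (fun w : C => Normc.normc w : R)
  (fun u : R => u ^+ 2)); first exact: continuous_normc.
exact: exprn_continuous.
Qed.

Lemma continuous_cplx : continuous (fun z : V * V => cplx z.1 z.2).
Proof.
move=> z A /nbhs_ballP[[e1 e2] /= e0 eA]; apply/nbhs_ballP.
move: e0; rewrite ltcE /= => /andP[/eqP e20 e10].
have e2' : 0 < e1 / 2 by rewrite divr_gt0.
exists (e1 / 2) => //= -[x y] [/= [_ zx] [_ zy]]; apply: eA.
split; first by rewrite /= ltcE /= e20 eqxx.
move=> i j; rewrite ord1 !mxE e20 /ball /= norm_complexE ltcR.
move: (zx ord0 j) (zy ord0 j); rewrite /ball /=.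
move: (z.1 ord0 j - x ord0 j) (z.2 ord0 j - y ord0 j) => u v u1 v1.
apply: (@le_lt_trans _ _ (`|u| + `|v|)); last by rewrite [e1]splitr ltrD.
rewrite -(ler_sqr _ _) ?nnegrE ?addr_ge0 ?sqrtr_ge0//.
rewrite sqr_sqrtr ?addr_ge0 ?sqr_ge0// -(real_normK (num_real u)) -(real_normK
  (num_real v)).
by rewrite sqrrD lerD2r lerDl mulrn_wge0// mulr_ge0.
Qed.

Lemma holomorphic_sqr_abs_continuous (Omega : set V) (F : 'rV[C]_n -> C) :
  holomorphic_on (tube_domain Omega) F -> forall z, (setT `*` Omega) z ->
  {for z, continuous (fun z : V * V => sqr_abs (F (cplx z.1 z.2)))}.
Proof.
move=> hF z Oz.
apply: (@continuous_comp _ _ _ (fun z : V * V => F (cplx z.1 z.2))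
  (fun w : C => sqr_abs w : R)); last exact: continuous_sqr_abs.
apply: (@continuous_comp _ _ _ (fun z : V * V => cplx z.1 z.2) F).
  exact: continuous_cplx.
apply: differentiable_continuous; apply: hF.
by exists z.
Qed.

End complex_coordinates.

Section tube_integral.
Variables (R : realType) (n : nat).
Local Notation V := 'rV[R]_n.
Variables (Omega : set V) (oOmega : open Omega) (phi : V -> R).
Hypotheses (phi_ge0 : forall y,
  Omega y -> 0 <= phi y) (mphi : measurable_fun Omega phi).
Local Open Scope ereal_scope.

Let D : set (V * V) := setT `*` Omega.

Let mOmega : measurable Omega. Proof. exact: open_measurable_rV. Qed.

Let mD : measurable D. Proof. exact: measurableX. Qed.

Variable f : V * V -> R.
Hypotheses (f0 : forall z, (0 <= f z)%R) (mf : measurable_fun D f).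

Let mfD : measurable_fun setT (f \_ D).
Proof. exact/(measurable_restrictT _ _).1. Qed.

Let mphiD : measurable_fun setT ((fun z : V * V => phi z.2) \_ D).
Proof.
apply/(measurable_restrictT _ _).1 => //.
apply: (@measurable_comp _ _ _ _ _ _ Omega) => //.
- by move=> _ [z [_ ?] <-].
- exact: measurable_funTS.
Qed.

Let msection (y : V) : measurable_fun [set: V] (fun x : V => (x, y) : V * V).
Proof. by apply: measurable_fun_pair;
  [exact: measurable_id|exact: measurable_cst]. Qed.

Let fD (x y : V) : Omega y -> (f \_ D) (x, y) = f (x, y).
Proof. by move=> Oy; rewrite patchE mem_set. Qed.

Lemma measurable_horizontal :
  measurable_fun Omega (fun y => \int[lebesgue_rV]_x (f (x, y))%:E).
Proof.
have fD0 z : (0 <= (f \_ D) z)%R by rewrite patchE; case: ifPn.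
pose G y := \int[@lebesgue_rV R n]_x ((f \_ D) (x, y))%:E.
have mG : measurable_fun setT G.
  apply: (measurable_fun_fubini_tonelli_G (m1 := @lebesgue_rV R n) (EFin \o
    (f \_ D))).
    by apply/measurable_EFinP; exact: mfD.
  by move=> z; rewrite /= lee_fin.
apply: (@eq_measurable_fun _ _ _ _ _ G); last exact: measurable_funTS.
move=> y /set_mem Oy; apply: eq_integral => x _.
by rewrite fD.
Qed.

Lemma integral_tube_measure :
  \int[tube_measure oOmega phi_ge0 mphi]_(z in D) (f z)%:E =
  \int[lebesgue_rV]_(y in Omega)
    ((\int[lebesgue_rV]_x (f (x, y))%:E) * (phi y)%:E).
Proof.
pose h := (fun z : V * V => phi z.2) \_ D.
have h0 z : (0 <= h z)%R.
  by rewrite /h patchE; case: ifPn => // /set_mem[_ /phi_ge0].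
have fD0 z : (0 <= (f \_ D) z)%R by rewrite patchE; case: ifPn.
rewrite integral_mkcond restrict_EFin.
rewrite (integral_density h0 mphiD (mu := @lebesgue_rV R n \x @lebesgue_rV R
  n)); first last.
- exact/measurable_EFinP.
- by move=> z; rewrite lee_fin.
- move=> A mA; rewrite /= /tube_density integral_mkcondr.
  by under eq_integral do rewrite restrict_EFin.
rewrite fubini_tonelli2; last 2 first.
- by apply: emeasurable_funM; exact/measurable_EFinP.
- by move=> z; rewrite mule_ge0// lee_fin.
rewrite [RHS]integral_mkcond; apply: eq_integral => y _.
rewrite /fubini_G patchE; case: ifPn => yO; last first.
  rewrite integral0_eq// => x _; rewrite /h !patchE memNset ?mul0e ?mule0//.
  by move=> [_ /mem_set]; exact/negP.
have Oy := set_mem yO.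
under eq_integral do rewrite /= /h fD// patchE mem_set//=.
rewrite ge0_integralZr//.
- apply/measurable_EFinP.
  have := measurableT_comp mfD (msection y).
  by rewrite (_ : _ \o _ = (fun x => f (x, y)))//; apply/funext => x;
    rewrite /= fD.
- by move=> x _; rewrite lee_fin.
- by rewrite lee_fin phi_ge0.
Qed.

End tube_integral.

(** * Carleson measures *)

Section hardy.
Variables (R : realType) (n : nat).
Local Notation V := 'rV[R]_n.
Local Notation C := (R[i] : numFieldType).
Variables (Omega : set V) (oOmega : open Omega) (phi : V -> R).
Hypotheses (phi_ge0 : forall y,
  Omega y -> 0 <= phi y) (mphi : measurable_fun Omega phi).
Local Open Scope ereal_scope.

Lemma open_tube : open ([set: V] `*` Omega).
Proof.
have -> : [set: V] `*` Omega = snd @^-1` Omega.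
  by apply/seteqP; split=> z //= [].
by apply: open_comp => // z _; exact: cvg_snd.
Qed.

Let mu := tube_measure oOmega phi_ge0 mphi.

Definition horizontal_sup (F : 'rV[C]_n -> C) : \bar R :=
  ereal_sup [set \int[lebesgue_rV]_x (sqr_abs (F (cplx x y)))%:E | y in Omega].

Lemma horizontal_sup_ge0 F : Omega !=set0 -> 0 <= horizontal_sup F.
Proof.
move=> [y Oy]; apply: (@le_trans _ _ (\int[lebesgue_rV]_x (sqr_abs (F
  (cplx x y)))%:E)).
  by apply: integral_ge0 => x _; rewrite lee_fin sqr_abs_ge0.
by apply: ereal_sup_ubound; exists y.
Qed.

Lemma hardy_norm_sqr F : Omega !=set0 -> hardy_norm Omega F ^+ 2 =
  horizontal_sup F.
Proof.
by move=> O0; rewrite /hardy_norm poweR12_sqrt ?sqr_sqrte// horizontal_sup_ge0.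
Qed.

Lemma integral_hardy F : holomorphic_on (tube_domain Omega) F ->
  \int[mu]_(z in setT `*` Omega) (sqr_abs (F (cplx z.1 z.2)))%:E =
  \int[lebesgue_rV]_(y in Omega)
    ((\int[lebesgue_rV]_x (sqr_abs (F (cplx x y)))%:E) * (phi y)%:E).
Proof.
move=> hF; rewrite (integral_tube_measure oOmega phi_ge0 mphi
  (f := fun z => sqr_abs (F (cplx z.1 z.2))))//.
  by move=> z; exact: sqr_abs_ge0.
apply: continuous_measurable_prod; last exact: holomorphic_sqr_abs_continuous.
exact: open_tube.
Qed.

Lemma measurable_hardy F : holomorphic_on (tube_domain Omega) F ->
  measurable_fun Omega (fun y => \int[lebesgue_rV]_x (sqr_abs (F
    (cplx x y)))%:E).
Proof.
move=> hF; apply: (measurable_horizontal oOmega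
  (f := fun z => sqr_abs (F (cplx z.1 z.2)))).
  by move=> z; exact: sqr_abs_ge0.
apply: continuous_measurable_prod; last exact: holomorphic_sqr_abs_continuous.
exact: open_tube.
Qed.

Let mOmega : measurable Omega. Proof. exact: open_measurable_rV. Qed.

Let mphiE : measurable_fun Omega (fun y => (phi y)%:E).
Proof. exact/measurable_EFinP. Qed.

Let phiE0 y : Omega y -> 0 <= (phi y)%:E.
Proof. by move=> Oy; rewrite lee_fin phi_ge0. Qed.

(** By Tonelli the left-hand side of the Carleson inequality is the integral over
Omega of phi times the square norms of the restrictions of F to the horizontal
slices, all of which are at most the square of the Hardy norm. *)
Lemma carleson_of_integrable : Omega !=set0 ->
  \int[lebesgue_rV]_(y in Omega) (phi y)%:E < +oo -> carleson_measure Omega mu.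
Proof.
move=> O0; set I := integral _ _ _ => Ioo.
have I0 : 0 <= I by exact: integral_ge0.
have If : I \is a fin_num by rewrite ge0_fin_numE.
exists (fine I + 1)%R; first by rewrite ltr_wpDl// fine_ge0.
move=> F [hF _]; rewrite integral_hardy// hardy_norm_sqr//.
have S0 := horizontal_sup_ge0 F O0.
apply: (@le_trans _ _ (\int[lebesgue_rV]_(y in Omega) (horizontal_sup F *
  (phi y)%:E))).
  apply: ge0_le_integral => //.
  - move=> y Oy; rewrite mule_ge0 ?phiE0//.
    by apply: integral_ge0 => x _; rewrite lee_fin sqr_abs_ge0.
  - by apply: emeasurable_funM => //; exact: measurable_hardy.
  - by apply: emeasurable_funM => //; exact: measurable_cst.
  - move=> y Oy; apply: lee_wpmul2r; first exact: phiE0.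
    by apply: ereal_sup_ubound; exists y.
rewrite ge0_integralZl// muleC lee_wpmul2r// -/I -(fineK If) lee_fin /=.
by rewrite lerDl.
Qed.

End hardy.

Section cauchy_products.
Variables (R : realType) (n : nat).
Local Notation V := 'rV[R]_n.
Local Notation C := (R[i] : numFieldType).

Definition linform (a x : V) : R := \sum_j a ord0 j * x ord0 j.

Definition complex_linform (a : V) (z : 'rV[C]_n) : C :=
  \sum_j ((a ord0 j)%:C)%C * z ord0 j.

Lemma complex_linformE (a x y : V) :
  complex_linform a (cplx x y) = (linform a x +i* linform a y)%C.
Proof.
rewrite /complex_linform /linform.
transitivity (\sum_j ((a ord0 j * x ord0 j) +i* (a ord0 j * y ord0 j))%C).
  apply: eq_bigr => j _; rewrite mxE; apply/eqP; rewrite eq_complex /=.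
  by rewrite !mul0r subr0 addr0 !eqxx.
by elim/big_rec3 : _ => //= j u v w _ ->.
Qed.

Lemma linformD (a b x : V) : linform (a + b) x = linform a x + linform b x.
Proof. by rewrite -big_split; apply: eq_bigr => j _; rewrite mxE mulrDl. Qed.

Lemma linform_delta i (x : V) : linform (delta_mx ord0 i) x = x ord0 i.
Proof.
rewrite /linform (bigD1 i)//= mxE !eqxx mul1r big1 ?addr0// => j ji.
by rewrite mxE (negbTE ji) andbF mul0r.
Qed.

Lemma differentiable_prod_seq (I : Type) (s : seq I) (f : I -> 'rV[C]_n ->
  C) z :
  (forall i, differentiable (f i) z) ->
  differentiable (fun z => \prod_(i <- s) f i z : C) z.
Proof.
move=> df; elim: s => [|i s IH].
  rewrite (_ : (fun _ => _) = cst 1); first exact: differentiable_cst.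
  by apply/funext => u; rewrite big_nil.
rewrite (_ : (fun _ => _) = f i * (fun z => \prod_(i <- s) f i z)).
  exact: differentiableM.
by apply/funext => u; rewrite big_cons.
Qed.

Lemma differentiable_complex_linform (a : V) z :
  differentiable (complex_linform a) z.
Proof.
rewrite /complex_linform; elim: (index_enum _) => [|i s IH].
  rewrite (_ : (fun _ => _) = cst 0); first exact: differentiable_cst.
  by apply/funext => u; rewrite big_nil.
rewrite (_ : (fun _ => _) = cst ((a ord0 i)%:C)%C *
  (fun z : 'rV[C]_n => z ord0 i : C) +
   (fun z : 'rV[C]_n => \sum_(j <- s) ((a ord0 j)%:C)%C * z ord0 j : C)).
  apply: differentiableD => //; apply: differentiableM.
    exact: differentiable_cst.
  exact: differentiable_coord.
by apply/funext => u; rewrite big_cons.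
Qed.

Variables (Omega : set V) (a : V).
Hypothesis aP : forall y, Omega y -> forall i, `|y ord0 i| <= linform a y.

Definition cauchy_factor (s : R) (b : V) (z : 'rV[C]_n) : C :=
  complex_linform b z + (0 +i* s)%C.

(** On the tube the imaginary part of each linear form is nonnegative, so that
all factors have imaginary part at least s. *)
Definition cauchy_product (s : R) (z : 'rV[C]_n) : C :=
  (\prod_i (cauchy_factor s a z * cauchy_factor s (a + delta_mx ord0 i) z))^-1.

Lemma sqr_abs_cauchy_factor s b (x y : V) :
  sqr_abs (cauchy_factor s b (cplx x y)) = linform b x ^+ 2 +
    (linform b y + s) ^+ 2.
Proof. rewrite /cauchy_factor complex_linformE -sqr_absE; congr sqr_abs.
by apply/eqP; rewrite eq_complex /= addr0 !eqxx. Qed.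

Lemma sqr_abs_cauchy_product s (x y : V) : sqr_abs (cauchy_product s
  (cplx x y)) =
  \prod_i ((linform a x ^+ 2 + (linform a y + s) ^+ 2) *
           ((linform a x + x ord0 i) ^+ 2 + (linform a y + y ord0 i + s) ^+
             2))^-1.
Proof.
rewrite /cauchy_product sqr_absV [RHS]prodfV.
rewrite (big_morph _ (@sqr_absM R) (_ : sqr_abs 1 = 1)); last first.
  by rewrite /sqr_abs Normc.normc1 expr1n.
congr (_^-1); apply: eq_bigr => i _.
by rewrite sqr_absM !sqr_abs_cauchy_factor !linformD !linform_delta.
Qed.

Section bounds.
Variable s : R.
Hypothesis s0 : 0 < s.

Let a_ge0 y (i : 'I_n) : Omega y -> 0 <= linform a y.
Proof. by move=> /aP /(_ i); apply: le_trans. Qed.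

Let aD_ge0 y (i : 'I_n) : Omega y -> 0 <= linform a y + y ord0 i.
Proof.
move=> /aP /(_ i); rewrite ler_norml => /andP[+ _].
by rewrite -subr_ge0 opprK addrC.
Qed.

Lemma cauchy_product_holomorphic : holomorphic_on (tube_domain Omega)
  (cauchy_product s).
Proof.
move=> _ [[x y] /= [_ Oy] <-]; apply: differentiableV.
  apply: differentiable_prod_seq => i.
  apply: differentiableM; apply: differentiableD;
    by [exact: differentiable_complex_linform|exact: differentiable_cst].
have cauchy_factor_neq0 b : 0 <= linform b y -> cauchy_factor s b
  (cplx x y) != 0.
  move=> b0; apply/eqP => fx; have := sqr_abs_cauchy_factor s b x y.
  rewrite fx /sqr_abs Normc.normc0 expr0n /= => /esym/eqP; apply/negP.
  by rewrite gt_eqF// ltr_wpDl ?sqr_ge0// exprn_gt0// ltr_wpDl.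
apply/prodf_neq0 => i _; rewrite mulf_neq0 ?cauchy_factor_neq0//;
  first exact: a_ge0.
by rewrite linformD linform_delta; exact: aD_ge0.
Qed.

(** With p = linform a x and u = x_i one has u^2 <= 2 p^2 + 2 (p + u)^2, hence
s^2 (s^2 + u^2) <= 2 (s^2 + p^2) (s^2 + (p + u)^2); the imaginary parts can only
increase the factors. *)
Lemma cauchy_product_upper (x y : V) : Omega y -> sqr_abs (cauchy_product s
  (cplx x y)) <=
  (2 / s ^+ 2) ^+ n * \prod_i (s ^+ 2 + x ord0 i ^+ 2)^-1.
Proof.
move=> Oy; rewrite sqr_abs_cauchy_product.
have -> : (2 / s ^+ 2) ^+ n = \prod_(i < n) (2 / s ^+ 2).
  by rewrite prodr_const card_ord.
rewrite -big_split /=.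
apply: ler_prod => i _.
have := a_ge0 i Oy; have := aD_ge0 i Oy.
move: (linform a x) (linform a y) (x ord0 i)
  (linform a y + y ord0 i) => p q u v v0 q0.
have s20 : 0 < s ^+ 2 by rewrite exprn_gt0.
have sD w : 0 <= w -> s ^+ 2 <= (w + s) ^+ 2.
  by move=> w0; rewrite ler_sqr ?nnegrE ?addr_ge0 ?(ltW s0)// lerDr.
have h1 : s ^+ 2 + p ^+ 2 <= p ^+ 2 + (q + s) ^+ 2 by rewrite addrC lerD2l sD.
have h2 : s ^+ 2 + (p + u) ^+ 2 <= (p + u) ^+ 2 + (v + s) ^+ 2.
  by rewrite addrC lerD2l sD.
have P1 : 0 < s ^+ 2 + p ^+ 2 by rewrite ltr_wpDr ?sqr_ge0.
have P2 : 0 < s ^+ 2 + (p + u) ^+ 2 by rewrite ltr_wpDr ?sqr_ge0.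
have P3 : 0 < s ^+ 2 + u ^+ 2 by rewrite ltr_wpDr ?sqr_ge0.
have Q1 := lt_le_trans P1 h1; have Q2 := lt_le_trans P2 h2.
apply/andP; split; first by rewrite invr_ge0 mulr_ge0 ?ltW.
have -> : 2 / s ^+ 2 / (s ^+ 2 + u ^+ 2) = (s ^+ 2 * (s ^+ 2 + u ^+ 2) / 2)^-1.
  by rewrite invf_div -mulrA -invfM.
rewrite lef_pV2 ?posrE; last 2 first.
- by rewrite mulr_gt0.
- by rewrite divr_gt0// mulr_gt0.
apply: le_trans (ler_pM (ltW P1) (ltW P2) h1 h2).
rewrite ler_pdivrMr//.
have : 0 <= s ^+ 2 * (p + (p + u)) ^+ 2 by rewrite mulr_ge0 ?sqr_ge0.
have : 0 <= p ^+ 2 * (p + u) ^+ 2 by rewrite mulr_ge0 ?sqr_ge0.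
by have := sqr_ge0 (s ^+ 2); lra.
Qed.

Let A := \sum_j `|a ord0 j|.

Let linform_cube (x : V) : cube s x -> `|linform a x| <= A * s.
Proof.
move=> sx; apply: le_trans (ler_norm_sum _ _ _) _; rewrite mulr_suml.
by apply: ler_sum => j _; rewrite normrM ler_wpM2l// ltW.
Qed.

(** Coordinates and linear forms are O(s) on the cube of side s, so every factor of
the denominator is O(s). *)
Lemma cauchy_product_lower (x y : V) : Omega y -> cube s x -> cube s y ->
  ((2 * (A + 2) ^+ 2) ^+ 2 * s ^+ 4) ^- n <= sqr_abs (cauchy_product s
    (cplx x y)).
Proof.
move=> Oy sx sy; rewrite sqr_abs_cauchy_product.
have -> : ((2 * (A + 2) ^+ 2) ^+ 2 * s ^+ 4) ^- n =
    \prod_(i < n) ((2 * (A + 2) ^+ 2) ^+ 2 * s ^+ 4)^-1.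
  by rewrite prodr_const card_ord exprVn.
have A0 : 0 <= A by apply: sumr_ge0 => j _; exact: normr_ge0.
have A2 : 0 < A + 2 by rewrite ltr_wpDl.
have K0 : 0 < (A + 2) ^+ 2 by rewrite exprn_gt0.
have sq (w : R) : `|w| <= (A + 2) * s -> w ^+ 2 <= (A + 2) ^+ 2 * s ^+ 2.
  move=> ws; rewrite -exprMn -(real_normK (num_real w)) ler_sqr ?nnegrE//.
  by rewrite mulr_ge0 ?(ltW A2) ?(ltW s0).
have Bs : 0 < (2 * (A + 2) ^+ 2) ^+ 2 * s ^+ 4.
  by rewrite mulr_gt0 ?exprn_gt0// mulr_gt0.
apply: ler_prod => i _; apply/andP; split; first by rewrite invr_ge0 ltW.
have lx := linform_cube sx; have ly := linform_cube sy.
have xi := ltW (sx i); have yi := ltW (sy i).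
have := a_ge0 i Oy; have := aD_ge0 i Oy.
move: (linform a x) (linform a y) (x ord0 i) (y ord0 i) lx ly xi yi.
move=> p q u v ps qs us vs v0 q0.
have [As AsE] : exists As : R, As = A * s by exists (A * s).
rewrite mulrDl -AsE in sq; rewrite -AsE in ps qs.
have s2 : s <= 2 * s by rewrite mulr_natl mulr2n lerDr ltW.
have E1 : p ^+ 2 <= (A + 2) ^+ 2 * s ^+ 2.
  by apply: sq; rewrite (le_trans ps)// lerDl mulr_ge0// ltW.
have E2 : (q + s) ^+ 2 <= (A + 2) ^+ 2 * s ^+ 2.
  by apply: sq; rewrite (le_trans (ler_normD _ _))// (gtr0_norm s0) lerD.
have E3 : (p + u) ^+ 2 <= (A + 2) ^+ 2 * s ^+ 2.
  by apply: sq; rewrite (le_trans (ler_normD _ _))// lerD// (le_trans us).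
have E4 : (q + v + s) ^+ 2 <= (A + 2) ^+ 2 * s ^+ 2.
  apply: sq; rewrite (le_trans (ler_normD _ _))// (gtr0_norm s0).
  by rewrite mulr_natl mulr2n addrA lerD2r (le_trans (ler_normD _ _))// lerD.
have F1 : 0 < p ^+ 2 + (q + s) ^+ 2.
  by rewrite ltr_wpDl ?sqr_ge0// exprn_gt0// ltr_wpDl.
have F2 : 0 < (p + u) ^+ 2 + (q + v + s) ^+ 2.
  by rewrite ltr_wpDl ?sqr_ge0// exprn_gt0// ltr_wpDl.
rewrite lef_pV2 ?posrE//; last by rewrite mulr_gt0.
have -> : (2 * (A + 2) ^+ 2) ^+ 2 * s ^+ 4 =
  (2 * ((A + 2) ^+ 2 * s ^+ 2)) * (2 * ((A + 2) ^+ 2 * s ^+ 2)) by ring.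
by apply: ler_pM; rewrite ?(ltW F1) ?(ltW F2)// mulr_natl mulr2n lerD.
Qed.

End bounds.

End cauchy_products.

Section carleson.
Variables (R : realType) (n : nat).
Local Notation V := 'rV[R]_n.
Variables (Omega : set V) (oOmega : open Omega) (phi : V -> R).
Hypotheses (phi_ge0 : forall y,
  Omega y -> 0 <= phi y) (mphi : measurable_fun Omega phi).
Hypothesis Omega0 : Omega !=set0.
Variable a : V.
Hypothesis aP : forall y, Omega y -> forall i, `|y ord0 i| <= linform a y.

Let B := (2 * (\sum_j `|a ord0 j| + 2) ^+ 2) ^+ 2.

Let B0 : 0 < B.
Proof.
by rewrite exprn_gt0// mulr_gt0// exprn_gt0// ltr_wpDl// sumr_ge0.
Qed.

Local Open Scope ereal_scope.

Let mOmega : measurable Omega. Proof. exact: open_measurable_rV. Qed.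

Section scale.
Variable s : R.
Hypothesis s0 : (0 < s)%R.

Let F := cauchy_product a s.

Let hF : holomorphic_on (tube_domain Omega) F.
Proof. exact: (cauchy_product_holomorphic aP s0). Qed.

Let mF y : Omega y -> measurable_fun [set: V] (fun x => sqr_abs (F (cplx x y))).
Proof.
move=> Oy; apply: continuous_measurable_rV => x.
apply: (@continuous_comp _ _ _ (fun x : V => (x, y) : V * V)
  (fun z => sqr_abs (F (cplx z.1 z.2)))).
  by apply: (@cvg_pair _ _ _ (nbhs x) (nbhs x) (nbhs y) _ _ _ id (fun=> y));
    [exact: cvg_id|exact: cvg_cst].
exact: holomorphic_sqr_abs_continuous hF _ _.
Qed.

Let F0 x y : 0 <= (sqr_abs (F (cplx x y)))%:E.
Proof. by rewrite lee_fin sqr_abs_ge0. Qed.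

Lemma horizontal_cauchy_product_upper y : Omega y ->
  \int[lebesgue_rV]_x (sqr_abs (F (cplx x y)))%:E <=
  ((2 / s ^+ 2) ^+ n * (pi / s) ^+ n)%:E.
Proof.
move=> Oy; pose k (x : R) := (s ^+ 2 + x ^+ 2)^-1%R.
have mk : measurable_fun setT k.
  exact: continuous_measurable_fun (continuous_cauchy_kernel s0).
have k0 x : (0 <= k x)%R by exact/ltW/cauchy_kernel_gt0.
have mprod := measurable_prod_coord (n := n) mk.
have c0 : (0 <= (2 / s ^+ 2) ^+ n)%R by rewrite
  exprn_ge0// divr_ge0// exprn_ge0// ltW.
apply: (@le_trans _ _ (\int[lebesgue_rV]_x
    (((2 / s ^+ 2) ^+ n)%:E * (\prod_i k (x ord0 i))%:E))).
  apply: ge0_le_integral => //.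
  - by apply/measurable_EFinP; exact: mF.
  - by apply: emeasurable_funM => //; apply/measurable_EFinP.
  - by move=> x _; rewrite -EFinM lee_fin;
    exact: (cauchy_product_upper aP s0 x Oy).
rewrite ge0_integralZl//; last 2 first.
- by apply/measurable_EFinP.
- by move=> x _; rewrite lee_fin prodr_ge0.
rewrite integral_prod_coord// integral_cauchy_kernel//.
by rewrite -EFin_expe -EFinM.
Qed.

Lemma horizontal_cauchy_product_lower y : Omega y -> cube s y ->
  ((B * s ^+ 4) ^- n * (2 * s) ^+ n)%:E <=
  \int[lebesgue_rV]_x (sqr_abs (F (cplx x y)))%:E.
Proof.
move=> Oy sy; pose k : R -> R := \1_(`](- s)%R, s[%classic).
have mk : measurable_fun setT k by exact: measurable_indic.
have k0 x : (0 <= k x)%R by [].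
have mprod := measurable_prod_coord (n := n) mk.
have c0 : (0 <= (B * s ^+ 4) ^- n)%R.
  by rewrite invr_ge0 exprn_ge0// mulr_ge0 ?(ltW B0)// exprn_ge0// ltW.
have -> : ((B * s ^+ 4) ^- n * (2 * s) ^+ n)%:E =
    \int[@lebesgue_rV R n]_x (((B * s ^+ 4) ^- n)%:E * (\prod_i k
      (x ord0 i))%:E).
  rewrite ge0_integralZl//; last 2 first.
  - by apply/measurable_EFinP.
  - by move=> x _; rewrite lee_fin prodr_ge0.
  rewrite integral_prod_coord// integral_indic// setIT.
  have vol : lebesgue_measure (`](- s)%R, s[%classic : set R) = (2 * s)%:E.
    by rewrite lebesgue_measure_itv/= lte_fin gtrN// -EFinD opprK mulr_natl
      mulr2n.
  transitivity (((B * s ^+ 4) ^- n)%:E * (2 * s)%:E ^+ n).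
    by rewrite -EFin_expe -EFinM.
  by rewrite -vol.
apply: ge0_le_integral => //.
- by move=> x _; rewrite mule_ge0 ?lee_fin// prodr_ge0.
- by apply: emeasurable_funM => //; apply/measurable_EFinP.
- by apply/measurable_EFinP; exact: mF.
move=> x _; rewrite -EFinM lee_fin.
have [sx|nsx] := pselect (cube s x).
  apply: (le_trans _ (cauchy_product_lower aP s0 Oy sx sy)).
  rewrite ler_piMr//; apply: (@le_trans _ _ (\prod_(i < n) 1)%R);
    last by rewrite big1.
  by apply: ler_prod => i _; rewrite k0 /= /k indicE; case: (_ \in _).
have [i si] : exists i, ~ (`|x ord0 i| < s)%R by exact/existsNP.
rewrite (bigD1 i)//= {1}/k indicE memNset ?mul0r ?mulr0 ?sqr_abs_ge0//.
by rewrite /= in_itv /= -ltr_norml.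
Qed.

(** The slices of the Cauchy product at scale s over the cube have square norms
at least l, and all its slices have square norms at most (pi B)^n l, where l
is the factor s^(- 3 n) up to a constant: it cancels. *)
Lemma integral_cube_le (c : R) : (0 < c)%R ->
  (forall F, hardy_space Omega F ->
    \int[tube_measure oOmega phi_ge0 mphi]_(z in setT `*` Omega)
      (sqr_abs (F (cplx z.1 z.2)))%:E <= c%:E * hardy_norm Omega F ^+ 2) ->
  \int[lebesgue_rV]_(y in Omega `&` cube s) (phi y)%:E <= (c *
    (pi * B) ^+ n)%:E.
Proof.
move=> c0 hc; set l := ((B * s ^+ 4) ^- n * (2 * s) ^+ n)%R.
have l0 : (0 < l)%R.
  have Bs : (0 < B * s ^+ 4)%R by rewrite mulr_gt0 ?B0// exprn_gt0.
  have s2 : (0 < 2 * s)%R by rewrite mulr_gt0.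
  by rewrite mulr_gt0 ?invr_gt0 ?exprn_gt0.
have lE : ((2 / s ^+ 2) ^+ n * (pi / s) ^+ n = (pi * B) ^+ n * l)%R.
  rewrite /l -(exprVn (B * s ^+ 4)%R) -!exprMn; congr (_ ^+ n)%R.
  by field; rewrite !gt_eqF.
have Sle : horizontal_sup Omega F <= ((pi * B) ^+ n * l)%:E.
  by apply: ge_ereal_sup => _ [y Oy <-]; rewrite -lE;
    exact: horizontal_cauchy_product_upper.
have hardyF : hardy_space Omega F.
  split=> //; apply: poweR_lty.
  exact: le_lt_trans Sle (ltry _).
have := hc _ hardyF; rewrite hardy_norm_sqr// integral_hardy// => hle.
have G0 y : 0 <= \int[lebesgue_rV]_x (sqr_abs (F (cplx x y)))%:E.
  by apply: integral_ge0 => x _; exact: F0.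
have mGphi : measurable_fun Omega (fun y =>
    \int[lebesgue_rV]_x (sqr_abs (F (cplx x y)))%:E * (phi y)%:E).
  apply: emeasurable_funM; first exact: measurable_hardy.
  exact/measurable_EFinP.
have mOs : measurable (Omega `&` cube s).
  by apply: measurableI => //; exact: measurable_cube.
have sub : Omega `&` cube s `<=` Omega by move=> y [].
have mphis : measurable_fun (Omega `&` cube s) (fun y => (phi y)%:E).
  by apply: measurable_funS mOmega sub _; exact/measurable_EFinP.
have key : l%:E * \int[lebesgue_rV]_(y in Omega `&` cube s) (phi y)%:E <=
    l%:E * (c * (pi * B) ^+ n)%:E.
  apply: (@le_trans _ _ (c%:E * horizontal_sup Omega F)); last first.
    rewrite -EFinM (mulrCA l) EFinM lee_wpmul2l ?lee_fin ?(ltW c0)//.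
    by rewrite mulrC.
  apply: le_trans hle; rewrite -ge0_integralZl//; last 2 first.
  - by move=> y [Oy _]; rewrite lee_fin phi_ge0.
  - by rewrite lee_fin ltW.
  apply: (@le_trans _ _ (\int[lebesgue_rV]_(y in Omega `&` cube s)
      (\int[lebesgue_rV]_x (sqr_abs (F (cplx x y)))%:E * (phi y)%:E))).
    apply: ge0_le_integral => //.
    - by move=> y [Oy _]; rewrite mule_ge0// lee_fin ?phi_ge0// ltW.
    - by apply: emeasurable_funM.
    - exact: measurable_funS mGphi.
    - move=> y [Oy sy]; rewrite lee_wpmul2r ?lee_fin ?phi_ge0//.
      exact: horizontal_cauchy_product_lower.
  apply: ge0_subset_integral => //.
  by move=> y Oy; rewrite mule_ge0// lee_fin phi_ge0.
by rewrite lee_pmul2l ?lte_fin// in key.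
Qed.

End scale.

Lemma integrable_of_carleson :
  carleson_measure Omega (tube_measure oOmega phi_ge0 mphi) ->
  \int[lebesgue_rV]_(y in Omega) (phi y)%:E < +oo.
Proof.
move=> [c c0 hc]; apply: (@le_lt_trans _ _ (c * (pi * B) ^+ n)%:E);
  last exact: ltry.
apply: integral_le_exhaustion => //.
- exact/measurable_EFinP.
- by move=> s s0; exact: integral_cube_le.
Qed.

End carleson.

(** * The determinant inequality and the theorem *)

Section determinant_bound.
Variables (R : realType) (m r : nat) (J : euclidean_jordan_algebra R m.+1).
Local Notation V := 'rV[R]_m.+1.
Local Notation e := (jone J).
Hypothesis simpleJ : simple_jordan_algebra J.
Variable Omega : set V.
Hypothesis hOmega : irreducible_symmetric_cone J Omega.
Hypothesis rankJ : jordan_rank J r.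
Variable Delta : V -> R.
Hypothesis hDelta : jordan_determinant J r Delta.
Variables (phi : V -> R).
Hypotheses (phi_ge0 : forall y,
  Omega y -> 0 <= phi y) (mphi : measurable_fun Omega phi).
Variable gam : R.
Hypothesis gam0 : gam <= 0.

Let mOmega : measurable Omega.
Proof. by apply: open_measurable_rV; exact: cone_open hOmega. Qed.

Let powR_le (x y : R) : 0 < x -> x <= y -> y `^ gam <= x `^ gam.
Proof.
move=> x0 xy; have y0 := lt_le_trans x0 xy.
have powE z : z `^ gam = (z `^ (- gam))^-1 by rewrite -powRN opprK.
rewrite !powE lef_pV2 ?posrE ?powR_gt0//.
by rewrite ge0_ler_powR ?nnegrE ?oppr_ge0// ltW.
Qed.

Let determinant_mono (t y : V) : Omega t -> Omega y -> Delta t <= Delta (y + t).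
Proof. by move=> Ot Oy; rewrite addrC;
  exact: (determinant_le hOmega simpleJ rankJ hDelta). Qed.

Let Delta_gt0 (t : V) : Omega t -> 0 < Delta t.
Proof. exact: (determinant_gt0 hOmega simpleJ rankJ hDelta). Qed.

Let mintegrand (t : V) :
  measurable_fun Omega (fun y => (Delta (y + t) `^ gam * phi y)%:E).
Proof.
apply/measurable_EFinP; apply: measurable_funM => //; apply: measurable_funTS.
apply: (measurableT_comp (measurable_powR gam) (g := fun y : V => Delta
  (y + t))).
apply: continuous_measurable_rV => y.
apply: (@continuous_comp _ _ _ (fun y : V => y + t) Delta).
  by apply: (@continuousD R V V id (cst t));
    [exact: cvg_id|exact: cst_continuous].
exact: (determinant_continuous hDelta).
Qed.

(** Here Delta (y + t) >= Delta t, and the exponent is nonpositive. *)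
Lemma determinant_bound_of_integrable :
  (\int[lebesgue_rV]_(y in Omega) (phi y)%:E < +oo)%E ->
  exists2 C : R, 0 < C & forall t, Omega t ->
    (\int[lebesgue_rV]_(y in Omega) (Delta (y + t) `^ gam * phi y)%:E
      <= (C * Delta t `^ gam)%:E)%E.
Proof.
set I := integral _ _ _ => Ioo.
have I0 : (0 <= I)%E by apply: integral_ge0 => y Oy; rewrite lee_fin phi_ge0.
have If : I \is a fin_num by rewrite ge0_fin_numE.
exists (fine I + 1) => [|t Ot]; first by rewrite ltr_wpDl// fine_ge0.
have mphiE : measurable_fun Omega (fun y =>
  (phi y)%:E) by exact/measurable_EFinP.
apply: (@le_trans _ _ (\int[lebesgue_rV]_(y in Omega) ((Delta t `^ gam)%:E *
  (phi y)%:E))%E).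
  apply: ge0_le_integral => //.
  - by move=> y Oy; rewrite lee_fin mulr_ge0 ?powR_ge0 ?phi_ge0.
  - by apply: emeasurable_funM => //; exact: measurable_cst.
  - move=> y Oy; rewrite -EFinM lee_fin ler_wpM2r ?phi_ge0//.
    by rewrite powR_le ?Delta_gt0// determinant_mono.
rewrite ge0_integralZl//; last by rewrite lee_fin powR_ge0.
by rewrite -/I -(fineK If) -EFinM lee_fin mulrC ler_wpM2r ?powR_ge0// lerDl.
Qed.

(** The bound is used at t = k e.  For y in the cone with coordinates less than
del k, the point k e - y is in the cone, so that Delta (y + k e) is at most
Delta (2 k e) = 2^r Delta (k e): the integral of phi over these y is bounded
independently of k. *)
Lemma integrable_of_determinant_bound (C : R) : 0 < C ->
  (forall t, Omega t ->
    (\int[lebesgue_rV]_(y in Omega) (Delta (y + t) `^ gam * phi y)%:E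
      <= (C * Delta t `^ gam)%:E)%E) ->
  (\int[lebesgue_rV]_(y in Omega) (phi y)%:E < +oo)%E.
Proof.
move=> C0 bound; have [del del0 near1] := cone_near_one hOmega.
have Oe := cone_one hOmega.
have mphiE : measurable_fun Omega (fun y =>
  (phi y)%:E) by exact/measurable_EFinP.
apply: (@le_lt_trans _ _ (C / (2 ^+ r) `^ gam)%:E); last exact: ltry.
apply: integral_le_exhaustion => // s s0.
pose k := s / del; have k0 : 0 < k by rewrite divr_gt0.
have Oke : Omega (k *: e) by exact: (coneZ hOmega k0 Oe).
set q := (2 ^+ r) `^ gam; set p := (k ^+ r) `^ gam.
have q0 : 0 < q by rewrite powR_gt0// exprn_gt0.
have p0 : 0 < p by rewrite powR_gt0// exprn_gt0.
have mOs : measurable (Omega `&` cube s).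
  by apply: measurableI => //; exact: measurable_cube.
have sub : Omega `&` cube s `<=` Omega by move=> y [].
have DE c : Delta (c *: e) = c ^+ r by exact:
  (determinant_scale_one rankJ hDelta).
have := bound _ Oke; rewrite DE -/p => hle.
suff key : ((q * p)%:E * \int[lebesgue_rV]_(y in Omega `&` cube s) (phi y)%:E
    <= (q * p)%:E * (C / q)%:E)%E.
  by rewrite lee_pmul2l ?lte_fin ?mulr_gt0// in key.
rewrite -EFinM (_ : q * p * (C / q) = C * p); last by field; rewrite gt_eqF.
apply: le_trans hle; rewrite -ge0_integralZl//; last 3 first.
- exact: measurable_funS mphiE.
- by move=> y [Oy _]; rewrite lee_fin phi_ge0.
- by rewrite lee_fin mulr_ge0// ltW.
apply: (@le_trans _ _ (\int[lebesgue_rV]_(y in Omega `&` cube s)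
    (Delta (y + k *: e) `^ gam * phi y)%:E)%E).
  apply: ge0_le_integral => //.
  - by move=> y [Oy _];
    rewrite -EFinM lee_fin mulr_ge0 ?phi_ge0// mulr_ge0// ltW.
  - by apply: emeasurable_funM;
    [exact: measurable_cst|exact: measurable_funS mphiE].
  - exact: measurable_funS (mintegrand _).
  - move=> y [Oy sy]; rewrite -EFinM lee_fin ler_wpM2r ?phi_ge0//.
    rewrite /q /p -powRM ?exprn_ge0 ?(ltW k0)// -exprMn -DE.
    have Oyk : Omega (y + k *: e) by exact: (coneD hOmega Oy Oke).
    apply: powR_le; first exact: Delta_gt0.
    have -> : (2 * k) *: e = (k *: e - y) + (y + k *: e).
      by rewrite addrA subrK -scalerDl mulr_natl mulr2n.
    apply: determinant_mono => //; apply: near1 => // i.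
    by rewrite mxE normrN /k mulrC divfK ?gt_eqF// sy.
apply: ge0_subset_integral => //.
by move=> y Oy; rewrite lee_fin mulr_ge0 ?powR_ge0 ?phi_ge0.
Qed.

End determinant_bound.

Theorem theorem3p1 (R : realType) (n r : nat)
    (J : euclidean_jordan_algebra R n) (simpleJ : simple_jordan_algebra J)
    (Omega : set 'rV[R]_n) (hOmega : irreducible_symmetric_cone J Omega)
    (rankJ : jordan_rank J r)
    (Delta : 'rV[R]_n -> R) (hDelta : jordan_determinant J r Delta)
    (phi : 'rV[R]_n -> R) (phi_ge0 : forall y, Omega y -> 0 <= phi y)
    (mphi : measurable_fun Omega phi) :
  let mu := tube_measure (irreducible_symmetric_cone_open hOmega) phi_ge0 mphi in
  let integrable_phi := (\int[lebesgue_rV]_(y in Omega) (phi y)%:E < +oo)%E in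
  let nr : R := n%:R / r%:R in
  let determinant_bound (alpha : R) :=
    exists2 C : R, 0 < C & forall t, Omega t ->
      (\int[lebesgue_rV]_(y in Omega)
          (Delta (y + t) `^ (- 2 * alpha + nr) * phi y)%:E
        <= (C * Delta t `^ (- 2 * alpha + nr))%:E)%E in
  [/\ carleson_measure Omega mu <-> integrable_phi,
      integrable_phi <->
        (exists2 alpha : R, nr - 1 / 2 < alpha & determinant_bound alpha) &
      integrable_phi <->
        (forall alpha : R, nr - 1 / 2 < alpha -> determinant_bound alpha)].
Proof.
move=> mu integrable_phi nr determinant_bound.
case: n => [|m] in J simpleJ Omega hOmega rankJ Delta hDelta phi phi_ge0 mphi mu
  integrable_phi nr determinant_bound *.
  by case: simpleJ.
have nr1 : 1 <= nr.
  have /andP[r0 rn] := jordan_rank_bounds rankJ.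
  by rewrite /nr ler_pdivlMr ?ltr0n// mul1r ler_nat.
have gam0 alpha : nr - 1 / 2 < alpha -> - 2 * alpha + nr <= 0 by lra.
have bound_all : integrable_phi -> forall alpha, nr - 1 / 2 < alpha -> determinant_bound alpha.
  move=> Iphi alpha /gam0 ag.
  exact: (determinant_bound_of_integrable simpleJ hOmega rankJ hDelta phi_ge0 mphi ag Iphi).
have integrable_some alpha : nr - 1 / 2 < alpha -> determinant_bound alpha -> integrable_phi.
  move=> /gam0 ag [C C0 bound].
  exact: (integrable_of_determinant_bound simpleJ hOmega rankJ hDelta phi_ge0 mphi ag C0 bound).
have alpha0 : nr - 1 / 2 < nr by lra.
have Omega0 : Omega !=set0 by exists (jone J); exact: cone_one hOmega.
have [K K0 coordK] := cone_coord_le hOmega.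
have [a aE] : exists a : 'rV[R]_m.+1, forall y, linform a y = K * jdot J y (jone J).
  exists (\row_j (K * jdot J (delta_mx ord0 j) (jone J))) => y.
  rewrite {2}[y]row_sum_delta jdot_suml mulr_sumr; apply: eq_bigr => j _.
  by rewrite mxE jdotZl; ring.
have aP y : Omega y -> forall i, `|y ord0 i| <= linform a y.
  by move=> Oy i; rewrite aE coordK.
split; split.
- exact: integrable_of_carleson aP.
- exact: carleson_of_integrable.
- by move=> Iphi; exists nr => //; exact: bound_all.
- by move=> [alpha]; exact: integrable_some.
- exact: bound_all.
- by move=> /(_ nr alpha0); exact: integrable_some.
Qed.
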